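(* Let $d,k\in\mathbb{N}$, $T\in(0,\infty)$, let $O\subseteq\mathbb{R}^d$ be a non-empty open set, let $\mu\in C^{0,1}([0,T]\times O,\mathbb{R}^d)$, $Y\in C^1([0,T],O)$, $X=(X_{s,t}^x)_{s\in[0,t],\,t\in[0,T],\,x\in O}\in C(\{(s,t)\in[0,T]^2\colon s\le t\}\times O,O)$, $f\in C^1(O,\mathbb{R}^k)$, and assume for all $s\in[0,T]$, $t\in[s,T]$, $x\in O$ that $$X_{s,t}^x=x+\int_s^t\mu(r,X_{s,r}^x)\,dr.$$ Then $$f\big(X_{0,T}^{Y_0}\big)-f(Y_T)=\int_0^Tf'\big(X_{s,T}^{Y_s}\big)\,\tfrac{\partial}{\partial x}X_{s,T}^{Y_s}\,\Big(\mu(s,Y_s)-\tfrac{d}{ds}Y_s\Big)\,ds.$$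
   Context: $C^{0,1}([0,T]\times O,\mathbb{R}^d)$ denotes the continuous functions $(t,x)\mapsto\mu(t,x)$ that are continuously differentiable in $x$ with derivative $\tfrac{\partial\mu}{\partial x}$ jointly continuous in $(t,x)$. $\tfrac{\partial}{\partial x}X_{s,T}^{Y_s}\in L(\mathbb{R}^d,\mathbb{R}^d)$ denotes the derivative of the map $O\ni x\mapsto X_{s,T}^x\in O$ evaluated at $x=Y_s$. *)

(* Defs.v *)
From mathcomp Require Export all_boot all_order all_algebra.
From mathcomp Require Export all_classical all_reals all_analysis.
Export numFieldNormedType.Exports.
Export Order.TTheory GRing.Theory Num.Theory.

Set Implicit Arguments.
Unset Strict Implicit.
Unset Printing Implicit Defensive.

Local Open Scope classical_set_scope.
Local Open Scope ring_scope.

(** Functions on [O], [[0, T]], [[0, T] * O], etc. are represented by total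
    functions of which only the values on these sets are constrained. *)

(** Derivative relative to a set [A] of times: at an endpoint of an interval it
    is the one-sided derivative. *)
Definition diff_quot_within (R : realType) (V : normedModType R)
    (A : set R) (y : R -> V) (t : R) : set_system V :=
  (fun h : R => h^-1 *: (y (h + t) - y t))
    @ within [set h | A (h + t)] (0 : R)^'.

Definition derivable1_within (R : realType) (V : normedModType R)
    (A : set R) (y : R -> V) (t : R) : Prop :=
  cvg (diff_quot_within A y t).

Definition derive1_within (R : realType) (V : normedModType R)
    (A : set R) (y : R -> V) (t : R) : V :=
  lim (diff_quot_within A y t).

Definition C1_time (R : realType) (V : normedModType R)
    (A : set R) (y : R -> V) : Prop :=
  (forall t, A t -> derivable1_within A y t) /\
  {within A, continuous (derive1_within A y)}.

(** In the next two definitions, continuity of the derivative as a map into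
    the finite-dimensional space of linear maps is continuity of the
    Jacobian matrix. *)
Definition C1_space (R : realType) (d k : nat)
    (O : set 'rV[R]_d) (f : 'rV[R]_d -> 'rV[R]_k) : Prop :=
  (forall x, O x -> differentiable f x) /\
  {within O, continuous (fun x => 'J f x)}.

Definition C01 (R : realType) (d k : nat) (I : set R)
    (O : set 'rV[R]_d) (mu : R -> 'rV[R]_d -> 'rV[R]_k) : Prop :=
  [/\ {within I `*` O, continuous (fun p : R * 'rV[R]_d => mu p.1 p.2)},
      (forall t x, I t -> O x -> differentiable (mu t) x) &
      {within I `*` O, continuous (fun p : R * 'rV[R]_d => 'J (mu p.1) p.2)}].

(** Vector-valued integrals are Lebesgue integrals taken componentwise. *)
Definition vintegrable (R : realType) (n : nat) (D : set R)
    (g : R -> 'rV[R]_n) : Prop :=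
  forall i : 'I_n,
    (@lebesgue_measure R).-integrable D (fun r => (g r ord0 i)%:E).

Definition vintegral (R : realType) (n : nat) (D : set R)
    (g : R -> 'rV[R]_n) : 'rV[R]_n :=
  \row_i (\int[@lebesgue_measure R]_(r in D) g r ord0 i).

(* Main.v *)
Require Import Defs.
From mathcomp Require Import ring lra.

(** The formula is the fundamental theorem of calculus for the function
    [s |-> f (X s T (Y s))], which runs from [f (X 0 T (Y 0))] to [f (Y T)].
    For [s <= t] the flow property gives [X s T (Y s) = X t T (X s t (Y s))]
    ([curve_flow]), so that, as [s] increases to [t], the function changes by
    the increment of the fixed map [f \o X t T] between the points
    [X s t (Y s)] and [Y t]. To first order these points differ by [t - s]
    times [mu t (Y t) - Y'(t)], so the left derivative of the function at [t]
    is minus the integrand ([left_derivative_along_curve]). Approaching [t]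
    from the left keeps the map fixed, so that this step needs its derivative
    at the single point [Y t] only. A continuous function with a continuous
    left derivative is a primitive of it ([left_derivative_FTC]), so it remains
    to differentiate the flow along [Y] and to see that the derivative depends
    continuously on the time.

    This is done without solving the linearized equation. For a shift [w] of
    the starting point let [D_w(t) = X s t (Y s + w) - X s t (Y s)]. The mean
    value inequality and the compactness of the set of pairs [s <= t] give
    [D_w' = D_w A + o(D_w)], where [A] is the Jacobian matrix of [mu] along the
    trajectory and the remainder is uniform in [s] and [t] ([mu_taylor]).
    Gronwall's inequality gives first [|D_w| <= C |w|] ([deviation_le]) and
    then, applied to [D_(a x + b y) - a D_x - b D_y], that [D] is linear in [w]
    up to [o(|w|)], uniformly in [s] ([deviation_approx_linear]). Any such
    approximately linear map is differentiable ([approx_linear_derivative]):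
    its difference quotients are Cauchy and their limits are linear. By
    uniformity the Jacobian matrix of [X s T] at [Y s] is a uniform limit of
    difference quotients that are continuous in [s] ([flow_jacobian_cont]). *)

Set Implicit Arguments.
Unset Strict Implicit.
Unset Printing Implicit Defensive.

Local Open Scope classical_set_scope.
Local Open Scope ring_scope.

(** * Matrices: entries, norms and limits *)

Section Matrices.
Variable R : realType.

Lemma mx_subE m n (A B : 'M[R]_(m, n)) i j :
  (A - B) i j = A i j - B i j.
Proof. by rewrite !mxE. Qed.

Lemma mx_entry_le_norm m n (A : 'M[R]_(m, n)) i j : `|A i j| <= `|A|.
Proof.
rewrite [leRHS]/Num.Def.normr /= mx_normrE.
exact: (le_bigmax _ (fun ij => `|A ij.1 ij.2|) (i, j)).
Qed.

Lemma mx_norm_le m n (A : 'M[R]_(m, n)) (c : R) :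
  0 <= c -> (forall i j, `|A i j| <= c) -> `|A| <= c.
Proof.
move=> c0 Ac; rewrite [leLHS]/Num.Def.normr /= mx_normrE.
by apply: bigmax_le => // -[i j] _; exact: Ac.
Qed.

Lemma norm_mulmx_le n m (v : 'rV[R]_n) (A : 'M[R]_(n, m)) :
  `|v *m A| <= n%:R * `|A| * `|v|.
Proof.
apply: mx_norm_le => [|i j]; first by rewrite !mulr_ge0.
rewrite mxE; apply: (le_trans (ler_norm_sum _ _ _)).
apply: (@le_trans _ _ (\sum_(k < n) `|A| * `|v|)).
  apply: ler_sum => k _; rewrite normrM mulrC.
  by apply: ler_pM => //; exact: mx_entry_le_norm.
by rewrite sumr_const card_ord -[leLHS]mulr_natl mulrA.
Qed.

Lemma coord_comp_continuous (T : topologicalType) m n (u : T -> 'M[R]_(m, n)) i j :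
  continuous u -> continuous (fun t => u t i j).
Proof.
move=> uc x.
exact: (@cvg_comp _ _ _ u (fun A : 'M[R]_(m, n) => A i j) _ _ _ (uc x)
  (@coord_continuous R m n i j (u x))).
Qed.

Lemma cvg_mx_entries (U : Type) (F : set_system U)
    (FF : Filter F) m n (A : U -> 'M[R]_(m, n)) (a : 'M[R]_(m, n)) :
  (forall i j, (fun t => A t i j) @ F --> a i j) -> A @ F --> a.
Proof.
move=> Aa; apply/cvgrPdist_le => e e0.
have : \forall t \near F, forall i j, `|a i j - A t i j| <= e.
  by apply: filter_forall => i; apply: filter_forall => j;
     move/cvgrPdist_le : (Aa i j); exact.
apply: filterS => t ate; apply: mx_norm_le => [|i j]; first exact: ltW.
by rewrite !mxE.
Qed.

Lemma cvg_mulmx (U : Type) (F : set_system U)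
    (FF : Filter F) m n p (A : U -> 'M[R]_(m, n)) (B : U -> 'M[R]_(n, p))
    (a : 'M[R]_(m, n)) (b : 'M[R]_(n, p)) :
  A @ F --> a -> B @ F --> b -> (fun t => A t *m B t) @ F --> a *m b.
Proof.
move=> Aa Bb; apply: cvg_mx_entries => i j.
have -> : (fun t => (A t *m B t) i j) = (fun t => \sum_k A t i k * B t k j).
  by apply/funext => t; rewrite mxE.
have -> : (a *m b) i j = \sum_k a i k * b k j by rewrite mxE.
have := (@cvg_big _ _ +%R 0 xpredT (@add_continuous R) _ F (index_enum 'I_n)
  (fun k t => A t i k * B t k j) (fun k => a i k * b k j) FF).
apply=> k _; apply: cvgM.
  exact: (@cvg_comp _ _ _ A (fun M : 'M[R]_(m, n) => M i k) _ _ _ Aa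
    (@coord_continuous R m n i k a)).
exact: (@cvg_comp _ _ _ B (fun M : 'M[R]_(n, p) => M k j) _ _ _ Bb
  (@coord_continuous R n p k j b)).
Qed.

End Matrices.

(** * Continuity relative to a set, and its uniformity on compact sets *)

Lemma cvg_within_comp (T U V : topologicalType) (A : set T) (B : set U)
    (g : T -> U) (f : U -> V) x :
  g @ within A (nbhs x) --> g x -> (\forall y \near within A (nbhs x), B (g y)) ->
  f @ within B (nbhs (g x)) --> f (g x) ->
  (f \o g) @ within A (nbhs x) --> f (g x).
Proof.
move=> gx gB fB P /fB fP.
apply: (@filterS _ (within A (nbhs x)) _ _ _ _ (filterI gB (gx _ fP))).
by move=> y [By]; apply.
Qed.

Lemma within_forall (T : topologicalType) (A : set T) (P : T -> Prop) (x : T) :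
  (forall q, A q -> P q) -> \forall q \near within A (nbhs x), P q.
Proof. by move=> AP; exact: (@filterE _ (nbhs x) _ (fun q => A q -> P q)). Qed.

Lemma cvg_within_pair (T U V : topologicalType) (A : set T) (f : T -> U)
    (g : T -> V) (x : T) (a : U) (b : V) :
  f @ within A (nbhs x) --> a -> g @ within A (nbhs x) --> b ->
  (fun t => (f t, g t)) @ within A (nbhs x) --> (a, b).
Proof.
move=> fa gb P [[B C] /= [aB bC] BCP]; have FI : within A (nbhs x) ((f @^-1` B) `&` (g @^-1` C)).
  by apply: filterI; [exact: fa|exact: gb].
apply: (@filterS _ (within A (nbhs x)) _ _ _ _ FI) => t [ft gt].
exact: (BCP (f t, g t)).
Qed.

Lemma near0_norm (R : realType) (V : normedModType R) (P : V -> Prop) :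
  (\forall w \near (0 : V), P w) ->
  exists2 r : R, 0 < r & forall w, `|w| < r -> P w.
Proof.
move=> /nbhs_normP[r /= r0 rP]; exists r => // w wr; apply: rP => /=.
by rewrite sub0r normrN.
Qed.

(** Continuity of [G] at the points [(p, 0)] is uniform over a compact set of
    parameters [p]: a tube-lemma argument, which covers the compact set by
    neighborhoods on which one neighborhood of [0] works. *)
Lemma compact_uniform_at0 (R : realType) (T : topologicalType)
    (V W : normedModType R) (K : set T) (G : T -> V -> W) :
  compact K ->
  (forall p, K p -> (fun q : T * V => G q.1 q.2)
     @ within [set q | K q.1] (nbhs (p, 0)) --> G p 0) ->
  forall e : R, 0 < e ->
  \forall w \near (0 : V), forall p, K p -> `|G p w - G p 0| < e.
Proof.
move=> cK Gc e e0.
have /near_covering_withinP := (compact_near_coveringP K).1 cK.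
apply => p Kp.
have e20 : 0 < e / 2 by rewrite divr_gt0.
have /cvgrPdist_lt/(_ _ e20) := Gc p Kp.
rewrite nearE /within /= => -[[U1 U2] [/= pU1 oU2] sub].
exists (U1, U2) => // -[p' w] [/= Up' U2w] Kp'.
have h1 := sub (p', w) (conj Up' U2w) Kp'.
have h2 := sub (p', 0) (conj Up' (nbhs_singleton oU2)) Kp'.
rewrite /= in h1 h2; rewrite [e]splitr (le_lt_trans (ler_distD (G p 0) _ _))//.
by rewrite ltrD// distrC.
Qed.

Lemma compact_uniform_open (R : realType) (T : topologicalType)
    (V : normedModType R) (K : set T) (O : set V) (c : T -> V) :
  compact K -> open O -> {within K, continuous c} -> (forall p, K p -> O (c p)) ->
  \forall w \near (0 : V), forall p, K p -> O (c p + w).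
Proof.
move=> cK oO /subspace_continuousP cc cO.
have /near_covering_withinP := (compact_near_coveringP K).1 cK.
apply => p Kp.
have /nbhs_ballP[e /= e0 eO] : nbhs (c p) O by apply: open_nbhs_nbhs; split => //; exact: cO.
have e20 : 0 < e / 2 by rewrite divr_gt0.
have /cvgrPdist_lt/(_ _ e20) h := cc p Kp.
have h0 : \forall w \near (0 : V), `|w| < e / 2.
  by have := @nbhs0_lt _ V _ e20.
exists ([set q | K q -> `|c p - c q| < e / 2], [set w | `|w| < e / 2]) => //.
move=> [q w] [/= hq hw] Kq; apply: eO; rewrite -ball_normE /=.
rewrite opprD addrA [e]splitr (le_lt_trans (ler_normB _ _))// ltrD//.
exact: hq.
Qed.

(** * First-order expansions *)

Section Expansions.
Variable R : realType.

Lemma jacobianE n m (F : 'rV[R]_n -> 'rV[R]_m) x v : 'd F x v = v *m 'J F x.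
Proof. by rewrite /jacobian mul_rV_lin1. Qed.

Lemma differentiable_expansion (V W : normedModType R) (F : V -> W) x (e : R) :
  differentiable F x -> 0 < e ->
  \forall h \near 0, `|F (h + x) - F x - 'd F x h| <= e * `|h|.
Proof.
move=> dF e0; have /eqaddoP/(_ _ e0) := diff_locally dF.
by apply: filterS => h /=; rewrite !fctE /= opprD addrA.
Qed.

Lemma differentiable_of_expansion n m (F : 'rV[R]_n -> 'rV[R]_m)
    (x : 'rV[R]_n) (A : 'M[R]_(n, m)) :
  (forall e : R, 0 < e ->
     \forall h \near (0 : 'rV[R]_n), `|F (h + x) - F x - h *m A| <= e * `|h|) ->
  differentiable F x /\ 'J F x = A.
Proof.
move=> FA.
pose L : {linear 'rV[R]_n -> 'rV[R]_m} := mulmxr A.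
have LA (h : 'rV[R]_n) r : `|h| <= r -> `|h *m A| <= n%:R * `|A| * r.
  by move=> hr; apply: le_trans (norm_mulmx_le _ _) _; rewrite ler_wpM2l.
have Lc : continuous L.
  apply/linear_bounded_continuous/bounded_funP => r.
  by exists (n%:R * `|A| * r) => h /LA.
have FL : (F : 'rV[R]_n -> 'rV[R]_m) \o shift x =
    cst (F x) + (L : 'rV[R]_n -> 'rV[R]_m) +o_ (0 : 'rV[R]_n) id.
  apply/eqaddoP => e /FA; apply: filterS => h.
  by rewrite !fctE /= opprD addrA.
have dE := diff_unique Lc FL.
split.
  by apply/diff_locallyP; rewrite dE; split.
by apply/row_matrixP => i; rewrite !rowE -jacobianE dE.
Qed.

(** A chain rule that asks for the differentiability of [H] at [x] alone and
    not for a derivative of [y] elsewhere. *)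
Lemma left_derivative_comp n m (H : 'rV[R]_n -> 'rV[R]_m)
    (x : 'rV[R]_n) (y : R -> 'rV[R]_n) (v : 'rV[R]_n) :
  differentiable H x ->
  h^-1 *: (y h - x) @[h --> (0 : R)^'-] --> v ->
  h^-1 *: (H (y h) - H x) @[h --> (0 : R)^'-] --> v *m 'J H x.
Proof.
move=> dH yv.
pose q (h : R) := h^-1 *: (y h - x).
have v1 : 0 < `|v| + 1 by rewrite ltr_wpDl.
have q_bnd : \forall h \near (0 : R)^'-, `|q h| <= `|v| + 1.
  have /cvgrPdist_lt/(_ _ ltr01) := yv.
  apply: filterS => h hv; rewrite -[q h](subKr v).
  by apply: (le_trans (ler_normB _ _)); rewrite lerD2l ltW.
have rem0 : h^-1 *: (H (y h) - H x - (y h - x) *m 'J H x) @[h --> (0 : R)^'-] --> (0 : 'rV[R]_m).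
  apply/cvgrPdist_le => e e0; have e1 : 0 < e / (`|v| + 1) by rewrite divr_gt0.
  have [r r0 Hr] := near0_norm (differentiable_expansion dH e1).
  near=> h.
  have h0 : h < 0 by near: h; exact: nbhs_left_lt.
  have qh : `|q h| <= `|v| + 1 by near: h.
  have hE : y h - x = h *: q h by rewrite /q scalerA divff ?scale1r// lt_eqF.
  have hr : `|y h - x| < r.
    rewrite hE normrZ; apply: (@le_lt_trans _ _ (`|h| * (`|v| + 1))).
      by rewrite ler_wpM2l.
    rewrite -ltr_pdivlMr// ltr0_norm// ltrNl; near: h; apply: nbhs_left_gt.
    by rewrite oppr_lt0 divr_gt0.
  have := Hr _ hr; rewrite subrK jacobianE => Hh.
  rewrite sub0r normrN normrZ normfV ler_pdivrMl ?normr_gt0 ?lt_eqF//.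
  apply: (le_trans Hh); rewrite [X in _ * `|X|]hE normrZ.
  rewrite mulrCA ler_wpM2l// mulrAC ler_pdivrMr// ler_wpM2l// ltW//.
have qJ : q h *m 'J H x @[h --> (0 : R)^'-] --> v *m 'J H x.
  by apply: cvg_mulmx => //; exact: cvg_cst.
rewrite -[X in _ --> X]addr0.
have -> : (fun h => h^-1 *: (H (y h) - H x)) = (fun h => q h *m 'J H x) +
   (fun h => h^-1 *: (H (y h) - H x - (y h - x) *m 'J H x)).
  by apply/funext => h; rewrite !fctE /= /q -scalemxAl -scalerDr [_ *m _ + _]addrC subrK.
exact: cvgD qJ rem0.
Unshelve. all: by end_near. Qed.

Lemma derivable1_within_continuous (V : normedModType R)
    (A : set R) (y : R -> V) (t : R) :
  derivable1_within A y t -> y @ within A (nbhs t) --> y t.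
Proof.
move=> /cvg_ex[/= l /cvgrPdist_lt/(_ _ ltr01) yl].
have [r r0 ry] : exists2 r : R, 0 < r & forall h, `|h| < r -> h != 0 -> A (h + t) ->
    `|l - h^-1 *: (y (h + t) - y t)| < 1.
  by apply: (near0_norm yl).
apply/cvgrPdist_lt => e e0.
suff : \forall x \near t, A x -> `|y t - y x| < e by [].
have C0 : 0 < `|l| + 1 by rewrite ltr_wpDl.
near=> x => Ax.
have [->|xt] := eqVneq x t; first by rewrite subrr normr0.
have h0 : x - t != 0 by rewrite subr_eq0.
have := ry (x - t); rewrite subrK => /(_ _ h0 Ax) H.
have {}H : `|l - (x - t)^-1 *: (y x - y t)| < 1.
  by apply: H; near: x; apply: cvgr_distC_lt => //; exact: cvg_id.
have yx : `|(x - t)^-1 *: (y x - y t)| <= `|l| + 1.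
  rewrite -[_ *: _](subKr l); apply: (le_trans (ler_normB _ _)).
  by rewrite lerD2l ltW.
rewrite distrC; move: yx; rewrite normrZ normfV ler_pdivrMl ?normr_gt0// => yx.
apply: (le_lt_trans yx); rewrite -ltr_pdivlMr//.
near: x; apply: cvgr_distC_lt; first exact: cvg_id.
by rewrite divr_gt0.
Unshelve. all: by end_near. Qed.

(** Both [F - f] and [F + f] have a nonnegative derivative. *)
Lemma derivative_comparison (f F : R -> R) (f' F' : R -> R) a b : a <= b ->
  {within `[a, b], continuous f} -> {within `[a, b], continuous F} ->
  (forall t : R, t \in `]a, b[ -> is_derive t 1 f (f' t)) ->
  (forall t : R, t \in `]a, b[ -> is_derive t 1 F (F' t)) ->
  (forall t : R, t \in `]a, b[ -> `|f' t| <= F' t) ->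
  `|f b - f a| <= F b - F a.
Proof.
move=> ab fc Fc fd Fd f'F'.
suff H (sg : R) : `|sg| = 1 -> sg * (f b - f a) <= F b - F a.
  rewrite ler_norml lerNl; apply/andP; split.
    by have := H (-1); rewrite normrN1 mulN1r; exact.
  by have := H 1; rewrite normr1 mul1r; exact.
move=> sg1.
pose h := F - sg *: f.
have hc : {within `[a, b], continuous h}.
  move=> x; apply: (@cvgB _ _ _ (nbhs x)); first exact: Fc.
  by apply: (@cvgM _ _ (nbhs x)); [exact: cvg_cst|exact: fc].
have hd t : t \in `]a, b[ -> is_derive t 1 h (F' t - sg * f' t).
  move=> tab; have := fd t tab; have := Fd t tab => *.
  exact: is_deriveB.
move: ab; rewrite le_eqVlt => /predU1P[->|ab]; first by rewrite !subrr mulr0.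
have [x xab hE] := MVT ab hd hc.
have {}hE : F b - sg * f b - (F a - sg * f a) = (F' x - sg * f' x) * (b - a).
  exact: hE.
rewrite -subr_ge0.
have -> : F b - F a - sg * (f b - f a) = (F' x - sg * f' x) * (b - a).
  by rewrite -hE; ring.
rewrite mulr_ge0 ?subr_ge0 ?(ltW ab)//.
apply: le_trans (f'F' _ xab); apply: (le_trans (ler_norm _)).
by rewrite normrM sg1 mul1r.
Qed.

Lemma coord_is_derive n (u : R -> 'rV[R]_n) (t : R) (du : 'rV[R]_n) j :
  is_derive t 1 u du -> is_derive t 1 (fun t : R => u t 0 j) (du 0 j).
Proof.
move=> [/[dup] ud /derivable_mxP/(_ 0 j) ujd uE]; apply: DeriveDef => //.
by have := congr1 (fun A : 'rV[R]_n => A 0 j) (derive_mx ud); rewrite uE mxE.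
Qed.

(** The mean value theorem for each coordinate of [F] minus the linear map [A],
    whose Jacobian matrix has entries at most [e] along the segment. The factor
    [n] compares the operator norm of a matrix with its largest entry. *)
Lemma mean_value_le n m (F : 'rV[R]_n -> 'rV[R]_m) (A : 'M[R]_(n, m))
    (x w : 'rV[R]_n) (e : R) :
  (forall a : R, 0 <= a <= 1 ->
     differentiable F (x + a *: w) /\ `|'J F (x + a *: w) - A| <= e) ->
  `|F (x + w) - F x - w *m A| <= n%:R * e * `|w|.
Proof.
move=> dF.
have e0 : 0 <= e.
  have [|_] := dF 0; first by rewrite lexx ler01.
  exact: le_trans.
apply: mx_norm_le => [|i j]; first by rewrite !mulr_ge0.
rewrite (ord1 i) {i}.
pose ga (a : R) := x + a *: w.
pose h (a : R) := F (ga a) 0 j.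
have hd (a : R) : 0 <= a <= 1 -> is_derive a 1 h ((w *m 'J F (ga a)) 0 j).
  move=> /dF[dFa _].
  have dga : is_diff a ga (fun t => t *: w).
    rewrite /ga.
    by apply: is_diff_eq; rewrite add0r.
  apply: coord_is_derive.
  have dFg : differentiable (F \o ga) a by apply: differentiable_comp.
  apply: DeriveDef; first exact: diff_derivable.
  rewrite deriveE// diff_comp//= diff_val scale1r.
  exact: jacobianE.
have hc : {within `[0, 1], continuous h}.
  by apply: derivable_within_continuous => a; rewrite in_itv /= => /hd[].
have hd' (a : R) : a \in `]0, 1[ -> is_derive a 1 h ((w *m 'J F (ga a)) 0 j).
  by rewrite in_itv /= => /andP[a0 a1]; apply: hd; rewrite !ltW.
have [a] := MVT_segment ler01 hd' hc.
rewrite in_itv /= => /dF[_ Ja].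
rewrite /h /ga scale0r scale1r addr0 subr0 mulr1 => hE.
have -> : (F (x + w) - F x - w *m A) 0 j = (w *m ('J F (ga a) - A)) 0 j.
  by rewrite mulmxBr mxE [in RHS]mxE -hE !mxE.
apply: (le_trans (mx_entry_le_norm _ _ _)).
apply: (le_trans (norm_mulmx_le _ _)).
by rewrite ler_wpM2r// ler_wpM2l.
Qed.

End Expansions.

(** * Gronwall's inequality *)

(** Bielecki's argument: if [K] is the maximum over [`[s, T]] of [`|u t|]
    weighted by [expR (- (2 * M * (t - s)))], then integrating the bound on [g]
    reproduces [K] with a factor [1 / 2] only, so that [K] is at most twice the
    contribution of the data. The coordinates are compared with an explicit
    primitive, because the sup norm of [u] need not be differentiable. *)
Lemma gronwall (R : realType) n (u g : R -> 'rV[R]_n) (s T M b : R) :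
  s <= T -> 0 < M -> 0 <= b ->
  {within `[s, T], continuous u} ->
  (forall t : R, t \in `]s, T[ -> forall j, is_derive t 1 (fun t : R => u t 0 j) (g t 0 j)) ->
  (forall t : R, t \in `]s, T[ -> `|g t| <= M * `|u t| + b) ->
  forall t : R, t \in `[s, T] ->
    `|u t| <= 2 * (`|u s| + b * (T - s)) * expR (2 * M * (T - s)).
Proof.
move=> sT M0 b0 uc ud gb.
pose w t := `|u t| * expR (- (2 * M * (t - s))).
have Ec (k : R) : continuous (fun t => expR (k * (t - s))).
  move=> t; apply: continuous_comp; last exact: continuous_expR.
  apply: (@cvgM _ _ (nbhs t)); first exact: cvg_cst.
  by apply: (@cvgB _ _ _ (nbhs t)); [exact: cvg_id|exact: cvg_cst].
have wc : {within `[s, T], continuous w}.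
  move=> x; apply: (@cvgM _ _ (nbhs x)).
    by apply: continuous_comp; [exact: uc|exact: norm_continuous].
  apply: continuous_subspaceT => t.
  by have := Ec (- (2 * M)) t; under eq_fun do rewrite mulNr.
have [t0 t0s wmax] := EVT_max sT wc.
set K := w t0 in wmax.
have K0 : 0 <= K by rewrite mulr_ge0// expR_ge0.
have uK (t : R) : t \in `[s, T] -> `|u t| <= K * expR (2 * M * (t - s)).
  move=> /wmax; rewrite /w expRN ler_pdivrMr ?expR_gt0//.
pose B := `|u s| + b * (T - s).
have uB (t : R) : t \in `[s, T] -> `|u t| <= B + K / 2 * expR (2 * M * (t - s)).
  rewrite in_itv /= => /andP[st tT].
  apply: mx_norm_le => [|i j].
    by rewrite addr_ge0 ?mulr_ge0 ?addr_ge0 ?expR_ge0// mulr_ge0// subr_ge0.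
  rewrite (ord1 i) {i}.
  pose G t := b * (t - s) + K / 2 * expR (2 * M * (t - s)).
  have sub (r : R) : r \in `]s, t[ -> r \in `]s, T[.
    by rewrite !in_itv /= => /andP[-> /lt_le_trans]; exact.
  have := @derivative_comparison R (fun t : R => u t 0 j) G (fun t => g t 0 j)
    (fun t => b + K * M * expR (2 * M * (t - s))) s t st.
  have -> : G t - G s = b * (t - s) + K / 2 * expR (2 * M * (t - s)) - K / 2.
    by rewrite /G subrr !mulr0 expR0; ring.
  move=> H.
  have : `|u t 0 j - u s 0 j| <= b * (t - s) + K / 2 * expR (2 * M * (t - s)) - K / 2.
    apply: H.
    - apply: (@continuous_subspaceW _ _ _ `[s, T]).
        by apply: subset_itvl; rewrite bnd_simp.
      exact: (coord_comp_continuous (T := subspace `[s, T])).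
    - apply: continuous_subspaceT => x.
      apply: (@cvgD _ _ _ (nbhs x)).
        apply: (@cvgM _ _ (nbhs x)); first exact: cvg_cst.
        by apply: (@cvgB _ _ _ (nbhs x)); [exact: cvg_id|exact: cvg_cst].
      by apply: (@cvgM _ _ (nbhs x)); [exact: cvg_cst|exact: Ec].
    - by move=> r /sub /ud.
    - move=> r _.
      have d1 : is_derive r 1 (fun t : R => t - s) 1.
        by apply: is_derive_eq; rewrite subr0.
      have d2 : is_derive r 1 (fun t : R => 2 * M * (t - s)) (2 * M).
        by apply: is_derive_eq; rewrite /GRing.scale /=; ring.
      have d3 := @is_derive1_comp _ expR (fun t : R => 2 * M * (t - s)) r _ _
        (is_derive_expR _) d2.
      have d4 := is_deriveD (is_deriveZ b d1) (is_deriveZ (K / 2) d3).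
      apply: (is_derive_eq d4).
      by rewrite /GRing.scale /=; field.
    - move=> r rs; apply: (le_trans (mx_entry_le_norm _ _ _)).
      apply: (le_trans (gb _ (sub _ rs))); rewrite /= addrC lerD2l.
      rewrite (mulrC K) -(mulrA M) ler_pM2l//; apply: uK.
      by have := sub _ rs; rewrite !in_itv /= => /andP[/ltW-> /ltW->].
  move=> H1; have := ler_normD (u t 0 j - u s 0 j) (u s 0 j).
  rewrite subrK; have := mx_entry_le_norm (u s) 0 j.
  have : b * (t - s) <= b * (T - s) by rewrite ler_wpM2l// lerB.
  rewrite /B; lra.
have KB : K <= 2 * B.
  have := uB _ t0s; have -> : `|u t0| = K * expR (2 * M * (t0 - s)).
    by rewrite /K /w expRN mulfVK// gt_eqF ?expR_gt0.
  have : 1 <= expR (2 * M * (t0 - s)).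
    rewrite -expR0 ler_expR mulr_ge0 ?mulr_ge0 ?(ltW M0)// subr_ge0.
    by move: t0s; rewrite in_itv /= => /andP[].
  move: (expR _) => E E1 h.
  have : 0 <= B by rewrite addr_ge0 ?mulr_ge0// subr_ge0.
  have : K * 1 <= K * E by rewrite ler_wpM2l.
  nra.
move=> t tsT; apply: (le_trans (uK _ tsT)).
apply: ler_pM; rewrite ?expR_ge0//.
rewrite ler_expR ler_pM2l ?mulr_gt0// lerB//.
by move: tsT; rewrite in_itv /= => /andP[].
Qed.

(** * Approximately linear maps *)

Section ApproximateLinearity.
Variables (R : realType) (I : Type) (S : set I) (n m : nat).
Variable D : I -> 'rV[R]_n -> 'rV[R]_m.
Hypothesis D_lin : forall e : R, 0 < e -> exists2 r : R, 0 < r &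
  forall s, S s -> forall (a b : R) (x y : 'rV[R]_n),
    `|x| < r -> `|y| < r -> `|a *: x + b *: y| < r ->
    `|D s (a *: x + b *: y) - (a *: D s x + b *: D s y)| <=
      e * (`|a *: x + b *: y| + `|a *: x| + `|b *: y|).

Let q s (x : 'rV[R]_n) (h : R) : 'rV[R]_m := h^-1 *: D s (h *: x).

Let q_cauchy (e : R) : 0 < e -> exists2 r : R, 0 < r &
  forall s, S s -> forall (x : 'rV[R]_n) (h k : R), h != 0 -> k != 0 ->
    `|h *: x| < r -> `|k *: x| < r -> `|q s x h - q s x k| <= e * `|x|.
Proof.
move=> e0; have e20 : 0 < e / 2 by rewrite divr_gt0.
have [r r0 Dr] := D_lin e20; exists r => // s Ss x h k h0 k0 hx kx.
have := Dr s Ss (h / k) 0 (k *: x) (k *: x) kx kx.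
rewrite !scale0r !addr0 scalerA divfK// normr0 addr0 => /(_ hx) H.
have -> : q s x h - q s x k = h^-1 *: (D s (h *: x) - (h / k) *: D s (k *: x)).
  by rewrite /q scalerBr scalerA mulrA mulVf// mul1r.
rewrite normrZ normfV ler_pdivrMl ?normr_gt0//.
apply: (le_trans H); rewrite normrZ le_eqVlt; apply/orP; left; apply/eqP.
by field.
Qed.

Let near0_scale_lt (r : R) (x : 'rV[R]_n) : 0 < r -> \forall h \near (0 : R)^', `|h *: x| < r.
Proof.
move=> r0; have p : 0 < r / (`|x| + 1) by rewrite divr_gt0// ltr_wpDl.
near=> h.
rewrite normrZ; apply: (@le_lt_trans _ _ (`|h| * (`|x| + 1))).
  by rewrite ler_wpM2l// lerDl.
rewrite -ltr_pdivlMr ?ltr_wpDl//.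
by near: h; exact: dnbhs0_lt.
Unshelve. all: by end_near. Qed.

Let L s x : 'rV[R]_m := lim (q s x @ (0 : R)^').

Let q_cvg s x : S s -> q s x @ (0 : R)^' --> L s x.
Proof.
move=> Ss; apply/cauchy_cvgP/cauchy_exP => e e0.
have p : 0 < e / (`|x| + 1) by rewrite divr_gt0// ltr_wpDl.
have [r r0 qr] := q_cauchy p.
near (0 : R)^' => k; exists (q s x k).
suff : \forall h \near (0 : R)^', `|q s x k - q s x h| < e.
  by apply: filterS => h; rewrite -ball_normE.
near=> h.
apply: (@le_lt_trans _ _ (e / (`|x| + 1) * `|x|)).
  apply: (qr s Ss x k h).
  - by near: k; exact: nbhs_dnbhs_neq.
  - by near: h; exact: nbhs_dnbhs_neq.
  - by near: k; exact: near0_scale_lt.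
  - by near: h; exact: near0_scale_lt.
rewrite mulrAC ltr_pdivrMr ?ltr_wpDl// ltr_pM2l//.
by rewrite ltrDl.
Unshelve. all: by end_near. Qed.

Let L_approx (e : R) : 0 < e -> exists2 r : R, 0 < r &
  forall s, S s -> forall (x : 'rV[R]_n) (h : R), h != 0 ->
    `|h *: x| < r -> `|q s x h - L s x| <= e * `|x|.
Proof.
move=> e0; have [r r0 qr] := q_cauchy e0; exists r => // s Ss x h h0 hx.
have qL : (fun k => `|q s x h - q s x k|) @ (0 : R)^' --> `|q s x h - L s x|.
  by apply: cvg_norm; apply: cvgB; [exact: cvg_cst|exact: q_cvg].
apply: (cvgr_to_le qL); near=> k; apply: (qr s Ss x h k h0 _ hx).
- by near: k; exact: nbhs_dnbhs_neq.
- by near: k; exact: near0_scale_lt.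
Unshelve. all: by end_near. Qed.

Let L_linear s (a b : R) x y : S s -> L s (a *: x + b *: y) = a *: L s x + b *: L s y.
Proof.
move=> Ss; apply/eqP; rewrite -subr_eq0 -normr_le0; apply/ler_addgt0Pl => e e0.
rewrite addr0; set z := a *: x + b *: y.
pose N := (2 * (`|z| + `|a *: x| + `|b *: y|)) + 1.
have N0 : 0 < N by rewrite ltr_wpDl// mulr_ge0// !addr_ge0.
have p : 0 < e / N by rewrite divr_gt0.
have [r r0 Dr] := D_lin p; have [r' r'0 Lr] := L_approx p.
have small (w : 'rV[R]_n) : \forall h \near (0 : R)^', `|h *: w| < Num.min r r'.
  by apply: near0_scale_lt; rewrite lt_min r0.
near (0 : R)^' => h.
have h0 : h != 0 by near: h; exact: nbhs_dnbhs_neq.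
have /andP[xr xr'] : (`|h *: x| < r) && (`|h *: x| < r').
  by rewrite -lt_min; near: h; exact: small.
have /andP[yr yr'] : (`|h *: y| < r) && (`|h *: y| < r').
  by rewrite -lt_min; near: h; exact: small.
have /andP[zr zr'] : (`|h *: z| < r) && (`|h *: z| < r').
  by rewrite -lt_min; near: h; exact: small.
have hz : a *: (h *: x) + b *: (h *: y) = h *: z.
  by rewrite /z scalerDr !scalerA mulrC [b * h]mulrC.
have H1 : `|q s z h - (a *: q s x h + b *: q s y h)| <=
    e / N * (`|z| + `|a *: x| + `|b *: y|).
  have := Dr s Ss a b (h *: x) (h *: y) xr yr; rewrite hz => /(_ zr) H.
  have -> : q s z h - (a *: q s x h + b *: q s y h) =
      h^-1 *: (D s (h *: z) - (a *: D s (h *: x) + b *: D s (h *: y))).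
    rewrite /q; move: (D s (h *: z)) (D s (h *: x)) (D s (h *: y)) => u v w.
    by apply/rowP => i; rewrite !mxE; ring.
  rewrite normrZ normfV ler_pdivrMl ?normr_gt0//.
  apply: (le_trans H); rewrite !normrZ le_eqVlt; apply/orP; left; apply/eqP.
  by ring.
have Hx := Lr s Ss x h h0 xr'; have Hy := Lr s Ss y h h0 yr'.
have Hz := Lr s Ss z h h0 zr'.
have -> : L s z - (a *: L s x + b *: L s y) =
   (q s z h - (a *: q s x h + b *: q s y h)) - (q s z h - L s z)
   + (a *: (q s x h - L s x) + b *: (q s y h - L s y)).
  move: (q s z h) (q s x h) (q s y h) (L s z) (L s x) (L s y) => *.
  by apply/rowP => i; rewrite !mxE; ring.
apply: (le_trans (ler_normD _ _)).
apply: (@le_trans _ _ (e / N * (`|z| + `|a *: x| + `|b *: y|) + e / N * `|z|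
   + (`|a| * (e / N * `|x|) + `|b| * (e / N * `|y|)))).
  apply: lerD.
    by apply: (le_trans (ler_normB _ _)); apply: lerD.
  by apply: (le_trans (ler_normD _ _)); apply: lerD; rewrite normrZ ler_wpM2l.
have -> : e / N * (`|z| + `|a *: x| + `|b *: y|) + e / N * `|z|
   + (`|a| * (e / N * `|x|) + `|b| * (e / N * `|y|)) = e / N * (N - 1).
  by rewrite /N !normrZ; ring.
rewrite mulrAC ler_pdivrMr// ler_pM2l//.
by rewrite lerBlDr lerDl.
Unshelve. all: by end_near. Qed.

(** With [b = 0] the hypothesis says that [D s (h *: x) / h] hardly depends on
    [h], so these quotients converge as [h] tends to [0]; the general case shows
    that the limit is linear in [x]. The modulus [r] is independent of [s], like
    the one of the hypothesis. *)
Lemma approx_linear_derivative : exists J : I -> 'M[R]_(n, m),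
  forall e : R, 0 < e -> exists2 r : R, 0 < r &
    forall s, S s -> forall x : 'rV[R]_n, `|x| < r ->
      `|D s x - x *m J s| <= e * `|x|.
Proof.
exists (fun s => \matrix_(i < n) L s (delta_mx 0 i)) => e e0.
have [r r0 Lr] := L_approx e0; exists r => // s Ss x xr.
have -> : x *m (\matrix_(i < n) L s (delta_mx 0 i)) = L s x.
  have L0 : L s 0 = 0.
    by have := @L_linear s 0 0 0 0 Ss; rewrite !scale0r !addr0.
  rewrite mulmx_sum_row [in RHS](row_sum_delta x).
  elim/big_rec2 : _ => // i y1 y2 _ ->.
  rewrite rowK; have := @L_linear s (x 0 i) 1 (delta_mx 0 i) y1 Ss.
  by rewrite !scale1r => ->.
by have := Lr s Ss x 1 (oner_neq0 _); rewrite /q invr1 !scale1r; exact.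
Qed.

End ApproximateLinearity.

(** * The fundamental theorem of calculus for left derivatives *)

Section OneSidedFTC.
Variable R : realType.
Local Notation leb := (@lebesgue_measure R).

Lemma is_derive_Rintegral (G : R -> R) (s T t : R) :
  {within `[s, T], continuous G} -> t \in `]s, T[ ->
  is_derive t 1 (fun t => \int[leb]_(r in `[s, t]) G r) (G t).
Proof.
move=> Gc /[dup] tsT; rewrite in_itv /= => /andP[st tT].
have Gi : leb.-integrable `[s, T] (EFin \o G).
  by apply: continuous_compact_integrable => //; exact: segment_compact.
have Gt : {for t, continuous G} by exact: within_continuous_continuous (lt_trans st tT) Gc tsT.
have [dP dE] := continuous_FTC1_closed tT Gi st Gt.
by apply: DeriveDef; [exact: dP|rewrite -derive1E; exact: dE].
Qed.

(** At a maximum point of [Q] other than [a] the left derivative would be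
    nonnegative, so the maximum is attained at [a]. *)
Lemma left_derivative_lt0_le (Q l : R -> R) (a b : R) : a <= b ->
  {within `[a, b], continuous Q} ->
  (forall t : R, t \in `]a, b] ->
     h^-1 * (Q (h + t) - Q t) @[h --> (0 : R)^'-] --> l t) ->
  (forall t : R, t \in `]a, b] -> l t < 0) -> Q b <= Q a.
Proof.
move=> ab Qc Ql l0.
have [t tab tmax] := EVT_max ab Qc.
move: tab; rewrite in_itv /= => /andP[+ tb].
rewrite le_eqVlt => /predU1P[ta|at_].
  by rewrite ta; apply: tmax; rewrite in_itv /= lexx ab.
have tab : t \in `]a, b] by rewrite in_itv /= at_.
have : 0 <= l t.
  apply: (cvgr_to_ge (Ql t tab)); near=> h.
  have h0 : h < 0 by near: h; exact: nbhs_left_lt.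
  apply: mulr_le0; first by rewrite invr_le0 ltW.
  rewrite subr_le0; apply: tmax; rewrite in_itv /=; apply/andP; split.
    rewrite -lerBlDr; near: h; apply: nbhs_left_ge.
    by rewrite subr_lt0.
  by rewrite (le_trans _ tb)// gerDr ltW.
by rewrite leNgt l0.
Unshelve. all: by end_near. Qed.

(** Two continuous functions with the same left derivative have the same
    increments: perturbed by a small negative slope, their difference has
    negative left derivative, and so has the opposite difference. This is
    applied to [f] and to the primitive of [g]. *)
Lemma left_derivative_FTC (f g : R -> R) (a b : R) : a < b ->
  {within `[a, b], continuous f} -> {within `[a, b], continuous g} ->
  (forall t : R, t \in `]a, b] ->
     h^-1 * (f (h + t) - f t) @[h --> (0 : R)^'-] --> g t) ->
  f b - f a = \int[leb]_(r in `[a, b]) g r.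
Proof.
move=> ab fc gc fg.
(* clamping the argument extends [g] continuously to the real line, so that its
   primitive is differentiable at [b] as well *)
pose G t := g (Num.max a (Num.min b t)).
have clampE t : t \in `[a, b] -> Num.max a (Num.min b t) = t.
  rewrite in_itv /= => /andP[at_ tb].
  by rewrite (min_idPr tb) (max_idPr at_).
have Gc : continuous G.
  move=> t.
  have cl : continuous (fun t : R => Num.max a (Num.min b t)).
    move=> x; apply: continuous_max; first exact: cst_continuous.
    by apply: continuous_min; [exact: cst_continuous|exact: cvg_id].
  have gcl : forall x : R, `[a, b]%classic (Num.max a (Num.min b x)).
    move=> x /=; rewrite in_itv /= le_max lexx /= ge_max (ltW ab) /=.
    by rewrite ge_min lexx.
  have /subspace_continuousP/(_ _ (gcl t)) gct := gc.
  have gclw : \forall y \near within setT (nbhs t),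
    `[a, b]%classic (Num.max a (Num.min b y)) by exact: nearW.
  have clw : (fun y : R => Num.max a (Num.min b y)) @ within setT (nbhs t)
      --> Num.max a (Num.min b t).
    by apply: cvg_trans (cl t); apply: cvg_app; exact: cvg_within.
  move=> P /(cvg_within_comp clw gclw gct) HP.
  by apply: (@filterS _ (nbhs t) _ _ _ _ HP) => y; exact.
pose P t := \int[leb]_(r in `[a, t]) G r.
have Pd (t : R) : t \in `]a, b] -> is_derive t 1 P (G t).
  rewrite in_itv /= => /andP[at_ tb].
  apply: (@is_derive_Rintegral _ _ (b + 1)); first exact: continuous_subspaceT.
  by rewrite in_itv /= at_ (le_lt_trans tb)// ltrDl.
have Pc : {within `[a, b], continuous P}.
  apply: parameterized_integral_continuous; first exact: ltW.
  apply: continuous_compact_integrable; first exact: segment_compact.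
  exact: continuous_subspaceT.
have Pa : P a = 0 by rewrite /P set_itv1 Rintegral_set1.
have -> : \int[leb]_(r in `[a, b]) g r = P b.
  by apply: eq_Rintegral => r; rewrite inE => rab; rewrite /G clampE.
have Pl (t : R) : t \in `]a, b] ->
    h^-1 * (P (h + t) - P t) @[h --> (0 : R)^'-] --> g t.
  move=> tab; have [dP dE] := Pd t tab.
  have <- : G t = g t.
    rewrite /G clampE//; move: tab; rewrite !in_itv /= => /andP[/ltW-> ->//].
  rewrite -dE; apply: cvg_dnbhs_at_left.
  have : (fun h : R => h^-1 *: (P (h *: (1 : R) + t) - P t)) @ (0 : R)^' --> 'D_1 P t.
    exact: dP.
  by under eq_fun do rewrite [_ *: 1]mulr1.
have key (F H : R -> R) : {within `[a, b], continuous F} ->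
    {within `[a, b], continuous H} ->
    (forall t : R, t \in `]a, b] ->
       h^-1 * (F (h + t) - F t) @[h --> (0 : R)^'-] --> g t) ->
    (forall t : R, t \in `]a, b] ->
       h^-1 * (H (h + t) - H t) @[h --> (0 : R)^'-] --> g t) ->
    F b - F a <= H b - H a.
  move=> Fc Hc Fl Hl; apply/ler_addgt0Pr => e e0.
  pose Q t := F t - H t - e / (b - a) * t.
  have Qba : Q b <= Q a.
    apply: (@left_derivative_lt0_le Q (fun t => g t - g t - e / (b - a))).
    - exact: ltW.
    - move=> x; apply: (@cvgB _ _ _ (nbhs x)).
        by apply: (@cvgB _ _ _ (nbhs x)); [exact: Fc|exact: Hc].
      apply: (@cvgM _ _ (nbhs x)); first exact: cvg_cst.
      by apply: continuous_subspaceT => y; exact: cvg_id.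
    - move=> t tab.
      have C : h^-1 * (F (h + t) - F t) - h^-1 * (H (h + t) - H t) - e / (b - a)
          @[h --> (0 : R)^'-] --> g t - g t - e / (b - a).
        apply: (@cvgB _ _ _ ((0 : R)^'-)); last exact: cvg_cst.
        by apply: (@cvgB _ _ _ ((0 : R)^'-)); [exact: Fl|exact: Hl].
      apply: cvg_trans C; apply: near_eq_cvg.
      near=> h.
      have h0 : h != 0 by rewrite lt_eqF//; near: h; exact: nbhs_left_lt.
      rewrite /Q; move: (e / (b - a)) => c.
      by field.
    - by move=> t _; rewrite subrr sub0r oppr_lt0 divr_gt0// subr_gt0.
  move: Qba; rewrite /Q.
  have : e / (b - a) * b - e / (b - a) * a = e.
    by rewrite -mulrBr divfK// subr_eq0 gt_eqF.
  lra.
apply/eqP; rewrite eq_le.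
have := key f P fc Pc fg Pl; have := key P f Pc fc Pl fg.
by rewrite Pa subr0 => -> ->.
Unshelve. all: by end_near. Qed.

End OneSidedFTC.

(** * Trajectories started on the curve [Y] *)

Section Flow.
Variables (R : realType) (d : nat) (T : R) (T_gt0 : 0 < T).
Variables (O : set 'rV[R]_d) (O_open : open O).
Variables (mu : R -> 'rV[R]_d -> 'rV[R]_d) (mu_C01 : C01 `[0, T] O mu).
Variables (Y : R -> 'rV[R]_d) (Y_C1 : C1_time `[0, T] Y).
Hypothesis Y_O : forall s, 0 <= s <= T -> O (Y s).
Variable X : R -> R -> 'rV[R]_d -> 'rV[R]_d.
Hypothesis X_cont : {within
  [set p : R * R * 'rV[R]_d | 0 <= p.1.1 <= p.1.2 /\ p.1.2 <= T /\ O p.2],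
  continuous (fun p : R * R * 'rV[R]_d => X p.1.1 p.1.2 p.2)}.
Hypothesis X_O : forall s t x, 0 <= s <= t -> t <= T -> O x -> O (X s t x).
Hypothesis X_eq : forall s t x, 0 <= s <= t -> t <= T -> O x ->
  X s t x = x + vintegral `[s, t] (fun r => mu r (X s r x)).

Let simplex := [set p : R * R | 0 <= p.1 <= p.2 /\ p.2 <= T].
Let curve (p : R * R) := X p.1 p.2 (Y p.1).

Lemma simplex_compact : compact simplex.
Proof.
have K : compact (`[0, T]%classic `*` `[0, T]%classic : set (R * R)).
  by apply: compact_setX; exact: segment_compact.
apply: (subclosed_compact _ K).
  have -> : simplex = (fun p : R * R => p.1) @^-1` [set x | 0 <= x] `&`
      (fun p : R * R => p.2 - p.1) @^-1` [set x | 0 <= x] `&`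
      (fun p : R * R => p.2) @^-1` [set x | x <= T].
    apply/seteqP; split => -[s t] /=; rewrite subr_ge0.
      by move=> [/andP[]].
    by move=> [[s0 st] tT]; split => //; apply/andP.
  apply: closedI; last first.
    by apply: closed_comp; [move=> p _; exact: cvg_snd|exact: closed_le].
  apply: closedI.
    by apply: closed_comp; [move=> p _; exact: cvg_fst|exact: closed_ge].
  apply: closed_comp; last exact: closed_ge.
  by move=> p _; apply: (@cvgB _ _ _ (nbhs p)); [exact: cvg_snd|exact: cvg_fst].
move=> [s t] [/= /andP[s0 st] tT]; split; rewrite /= in_itv /= ?s0 /=.
  exact: le_trans tT.
by rewrite tT (le_trans s0).
Qed.

Lemma Y_cont s : 0 <= s <= T -> Y @ within `[0, T] (nbhs s) --> Y s.
Proof. by move=> sT; apply/derivable1_within_continuous/Y_C1.1; rewrite /= in_itv. Qed.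

Lemma Y_fst_cont p : simplex p -> (fun q : R * R => Y q.1) @ within simplex (nbhs p) --> Y p.1.
Proof.
move=> [/andP[s0 st] tT].
apply: (@cvg_within_comp _ _ _ simplex `[0, T]%classic (fun q : R * R => q.1) Y p).
- by apply: cvg_within_filter; exact: cvg_fst.
- apply: within_forall => -[s' t'] [/= /andP[s'0 s't'] t'T].
  by rewrite /= in_itv /= s'0 (le_trans s't').
- by apply: Y_cont; rewrite s0 (le_trans st).
Qed.

Lemma flow_cont p x : simplex p -> O x ->
  (fun q : R * R * 'rV[R]_d => X q.1.1 q.1.2 q.2) @
    within [set q | simplex q.1 /\ O q.2] (nbhs (p, x)) --> X p.1 p.2 x.
Proof.
move=> [p1 p2] Ox; have /subspace_continuousP/(_ (p, x)) := X_cont.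
have -> : [set q : R * R * 'rV[R]_d | simplex q.1 /\ O q.2] =
    [set p : R * R * 'rV[R]_d | 0 <= p.1.1 <= p.1.2 /\ p.1.2 <= T /\ O p.2].
  by apply/seteqP; split => q /=; rewrite /simplex /=; tauto.
by apply.
Qed.

Lemma curve_O p : simplex p -> O (curve p).
Proof.
move=> [/andP[s0 st] tT]; apply: X_O => //; first by rewrite s0.
by apply: Y_O; rewrite s0 (le_trans st).
Qed.

Lemma flow_shifted_cont p w : simplex p -> O (Y p.1 + w) ->
  (fun q : R * R * 'rV[R]_d => X q.1.1 q.1.2 (Y q.1.1 + q.2)) @
    within [set q | simplex q.1] (nbhs (p, w)) --> X p.1 p.2 (Y p.1 + w).
Proof.
move=> Sp Ow.
have Yw : (fun q : R * R * 'rV[R]_d => Y q.1.1 + q.2) @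
    within [set q | simplex q.1] (nbhs (p, w)) --> Y p.1 + w.
  apply: cvgD; last by apply: cvg_within_filter; exact: cvg_snd.
  apply: (@cvg_within_comp _ _ _ [set q | simplex q.1] simplex
    (fun q : R * R * 'rV[R]_d => q.1) (fun q => Y q.1) (p, w)).
  - by apply: cvg_within_filter; exact: cvg_fst.
  - by apply: within_forall => q.
  - exact: Y_fst_cont.
apply: (@cvg_within_comp _ _ _ [set q | simplex q.1] [set q | simplex q.1 /\ O q.2]
  (fun q : R * R * 'rV[R]_d => (q.1, Y q.1.1 + q.2))
  (fun q : R * R * 'rV[R]_d => X q.1.1 q.1.2 q.2) (p, w)).
- by apply: cvg_within_pair => //; apply: cvg_within_filter; exact: cvg_fst.
- have : nbhs (Y p.1 + w) O by apply: open_nbhs_nbhs.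
  move=> /Yw; apply: (@filterS _ (nbhs (p, w))) => q /= qO Sq.
  by split => //; exact: qO.
- exact: flow_cont.
Qed.

Lemma curve_cvg p : simplex p -> curve @ within simplex (nbhs p) --> curve p.
Proof.
move=> Sp.
apply: (@cvg_within_comp _ _ _ simplex [set q | simplex q.1 /\ O q.2]
  (fun q : R * R => (q, Y q.1))
  (fun q : R * R * 'rV[R]_d => X q.1.1 q.1.2 q.2) p).
- apply: cvg_within_pair; last exact: Y_fst_cont.
  by apply: cvg_within_filter; exact: cvg_id.
- apply: within_forall => q Sq; split => //=.
  by apply: Y_O; case: Sq => /andP[-> /le_trans]; exact.
- apply: flow_cont => //; case: Sp => /andP[s0 st] tT.
  by apply: Y_O; rewrite s0 (le_trans st).
Qed.

Lemma curve_nbhs_O : exists2 r : R, 0 < r &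
  forall w, `|w| < r -> forall p, simplex p -> O (curve p + w).
Proof.
apply/near0_norm/compact_uniform_open => //; first exact: simplex_compact.
  by apply/subspace_continuousP => p; exact: curve_cvg.
exact: curve_O.
Qed.

(** Continuity of functions of time and state along the trajectories
    [curve (s, t)] and their small translates, in the form required by
    [compact_uniform_at0]. *)
Lemma along_shifted_curve_cont (m n : nat) (F : R * 'rV[R]_d -> 'M[R]_(m, n)) p :
  {within `[0, T] `*` O, continuous F} -> simplex p ->
  (fun q : R * R * 'rV[R]_d => F (q.1.2, curve q.1 + q.2)) @
    within [set q | simplex q.1] (nbhs (p, 0 : 'rV[R]_d)) --> F (p.2, curve p + 0).
Proof.
move=> /subspace_continuousP Fc Sp.
have cw : (fun q : R * R * 'rV[R]_d => curve q.1 + q.2) @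
    within [set q | simplex q.1] (nbhs (p, 0 : 'rV[R]_d)) --> curve p + 0.
  apply: cvgD; last by apply: cvg_within_filter; exact: cvg_snd.
  apply: (@cvg_within_comp _ _ _ [set q | simplex q.1] simplex
    (fun q : R * R * 'rV[R]_d => q.1) curve (p, 0 : 'rV[R]_d)).
  - by apply: cvg_within_filter; exact: cvg_fst.
  - by apply: within_forall => q.
  - exact: curve_cvg.
have It q : simplex q -> `[0, T]%classic q.2.
  by move=> [/andP[q0 q12] qT]; rewrite /= in_itv /= qT (le_trans q0).
apply: (@cvg_within_comp _ _ _ [set q | simplex q.1] (`[0, T] `*` O)
  (fun q : R * R * 'rV[R]_d => (q.1.2, curve q.1 + q.2)) F (p, 0 : 'rV[R]_d)).
- apply: cvg_within_pair => //; apply: cvg_within_filter.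
  by apply: (@cvg_comp _ _ _ fst snd) ; [exact: cvg_fst|exact: cvg_snd].
- have : nbhs (curve p + 0) O.
    by apply: open_nbhs_nbhs; split => //; rewrite addr0; exact: curve_O.
  move=> /cw; apply: (@filterS _ (nbhs (p, 0 : 'rV[R]_d))) => q /= qO Sq.
  by split; [exact: It|exact: qO].
- apply: Fc; split; first exact: It.
  by rewrite /= addr0; exact: curve_O.
Qed.

Lemma along_curve_cont (m n : nat) (F : R * 'rV[R]_d -> 'M[R]_(m, n)) p :
  {within `[0, T] `*` O, continuous F} -> simplex p ->
  (fun q => F (q.2, curve q)) @ within simplex (nbhs p) --> F (p.2, curve p).
Proof.
move=> Fc Sp.
have -> : (fun q => F (q.2, curve q)) = (fun q : R * R * 'rV[R]_d =>
    F (q.1.2, curve q.1 + q.2)) \o (fun q : R * R => (q, 0)).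
  by apply/funext => q /=; rewrite addr0.
have -> : F (p.2, curve p) = F (p.2, curve p + 0) by rewrite addr0.
apply: (@cvg_within_comp _ _ _ simplex [set q : R * R * 'rV[R]_d | simplex q.1]
  (fun q : R * R => (q, 0 : 'rV[R]_d))
  (fun q => F (q.1.2, curve q.1 + q.2)) p).
- apply: cvg_within_pair; last exact: cvg_cst.
  by apply: cvg_within_filter; exact: cvg_id.
- by apply: within_forall => q.
- exact: along_shifted_curve_cont.
Qed.

Lemma along_curve_bounded (m n : nat) (F : R * 'rV[R]_d -> 'M[R]_(m, n)) :
  {within `[0, T] `*` O, continuous F} ->
  exists2 M : R, 0 < M & forall p, simplex p -> `|F (p.2, curve p)| <= M.
Proof.
move=> Fc.
have Fcc : {within simplex, continuous (fun p : R * R => F (p.2, curve p))}.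
  by apply/subspace_continuousP => p; exact: along_curve_cont.
have := compact_bounded (continuous_compact Fcc simplex_compact).
move=> /ex_strict_bound_gt0[M M0 MF]; exists M => // p Sp.
by apply/ltW/MF; exists p.
Qed.

Lemma mu_jacobian_uniform (e : R) : 0 < e -> exists2 r : R, 0 < r &
  forall w, `|w| < r -> forall p, simplex p ->
    `|'J (mu p.2) (curve p + w) - 'J (mu p.2) (curve p)| < e.
Proof.
move=> e0; apply: near0_norm; case: mu_C01 => _ _ Jc.
have : \forall w \near (0 : 'rV[R]_d), forall p, simplex p ->
    `|'J (mu p.2) (curve p + w) - 'J (mu p.2) (curve p + 0)| < e.
  apply: (@compact_uniform_at0 R _ _ _ simplex
    (fun p w => 'J (mu p.2) (curve p + w)) simplex_compact _ _ e0) => p Sp.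
  exact: (along_shifted_curve_cont Jc Sp).
by apply: filterS => w Hw p Sp; have := Hw p Sp; rewrite addr0.
Qed.

Lemma deviation_uniform (e : R) : 0 < e -> exists2 r : R, 0 < r &
  forall w, `|w| < r -> forall p, simplex p ->
    `|X p.1 p.2 (Y p.1 + w) - curve p| < e.
Proof.
move=> e0; apply: near0_norm.
have : \forall w \near (0 : 'rV[R]_d), forall p, simplex p ->
    `|X p.1 p.2 (Y p.1 + w) - X p.1 p.2 (Y p.1 + 0)| < e.
  apply: (@compact_uniform_at0 R _ _ _ simplex
    (fun p w => X p.1 p.2 (Y p.1 + w)) simplex_compact _ _ e0) => p Sp.
  apply: flow_shifted_cont => //; rewrite addr0; apply: Y_O.
  by case: Sp => /andP[-> /le_trans]; exact.
by apply: filterS => w Hw p Sp; have := Hw p Sp; rewrite addr0.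
Qed.

(** The linearization of the vector field, with a remainder that is uniform
    over all the trajectories started on [Y]. *)
Lemma mu_taylor (e : R) : 0 < e -> exists2 r : R, 0 < r &
  forall w, `|w| < r -> forall p, simplex p ->
    `|mu p.2 (curve p + w) - mu p.2 (curve p) - w *m 'J (mu p.2) (curve p)|
      <= e * `|w|.
Proof.
move=> e0; have e'0 : 0 < e / d.+1%:R by rewrite divr_gt0.
have [r r0 rO] := curve_nbhs_O; have [r' r'0 rJ] := mu_jacobian_uniform e'0.
exists (Num.min r r'); first by rewrite lt_min r0.
move=> w; rewrite lt_min => /andP[wr wr'] p Sp.
apply: (@le_trans _ _ (d%:R * (e / d.+1%:R) * `|w|)).
  apply: mean_value_le => a /andP[a0 a1].
  have aw : `|a *: w| <= `|w| by rewrite normrZ ger0_norm// ler_piMl.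
  split; last by apply/ltW/rJ => //; exact: le_lt_trans wr'.
  case: mu_C01 => _ dmu _; apply: dmu.
    by case: Sp => /andP[p0 p12] pT; rewrite /= in_itv /= pT (le_trans p0).
  by apply: rO => //; exact: le_lt_trans wr.
rewrite ler_wpM2r// mulrCA ler_piMr// ?(ltW e0)//.
by rewrite ler_pdivrMr// mul1r ler_nat.
Qed.

Lemma mu_lipschitz : exists2 M : R, 0 < M & exists2 r : R, 0 < r &
  forall w, `|w| < r -> forall p, simplex p ->
    `|mu p.2 (curve p + w) - mu p.2 (curve p)| <= M * `|w|.
Proof.
case: mu_C01 => _ _ Jc; have [M M0 JM] := along_curve_bounded Jc.
have [r r0 rT] := mu_taylor ltr01.
exists (d%:R * M + 1); first by rewrite ltr_wpDl// mulr_ge0// ltW.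
exists r => // w wr p Sp.
rewrite -[_ - _](subrK (w *m 'J (mu p.2) (curve p))).
apply: (le_trans (ler_normD _ _)); rewrite mulrDl addrC lerD//; last exact: rT.
apply: (le_trans (norm_mulmx_le _ _)); rewrite ler_wpM2r// ler_wpM2l//.
exact: JM.
Qed.

Lemma flow_init s x : 0 <= s <= T -> O x -> X s s x = x.
Proof.
move=> /andP[s0 sT] Ox; rewrite X_eq ?s0 ?lexx//.
rewrite [vintegral _ _](_ : _ = 0) ?addr0//.
by apply/rowP => i; rewrite !mxE set_itv1 Rintegral_set1.
Qed.

Lemma flow_time_cont s x : 0 <= s <= T -> O x ->
  {within `[s, T], continuous (fun t => X s t x)}.
Proof.
move=> /andP[s0 sT] Ox; apply/subspace_continuousP => t /=.
rewrite in_itv /= => /andP[st tT].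
apply: (@cvg_within_comp _ _ _ `[s, T]%classic [set q | simplex q.1 /\ O q.2]
  (fun t : R => (s, t, x))
  (fun q : R * R * 'rV[R]_d => X q.1.1 q.1.2 q.2) t).
- apply: cvg_within_pair; last exact: cvg_cst.
  apply: cvg_within_pair; first exact: cvg_cst.
  by apply: cvg_within_filter; exact: cvg_id.
- apply: within_forall => q /=; rewrite in_itv /= => /andP[sq qT].
  by split => //; split => //=; rewrite s0.
- by apply: flow_cont => //; split => //=; rewrite s0.
Qed.

Lemma field_along_flow_cont s x : 0 <= s <= T -> O x ->
  {within `[s, T], continuous (fun t => mu t (X s t x))}.
Proof.
move=> /[dup] sT /andP[s0 _] Ox; apply/subspace_continuousP => t stT.
case: mu_C01 => /subspace_continuousP muc _ _.
have [st tT] : s <= t /\ t <= T by move: stT; rewrite /= in_itv /= => /andP[].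
have /subspace_continuousP Xc := flow_time_cont sT Ox.
have IO q : `[s, T]%classic q -> (`[0, T] `*` O) (q, X s q x).
  rewrite /= in_itv /= => /andP[sq qT]; split; rewrite /=.
    by rewrite in_itv /= qT (le_trans s0).
  by apply: X_O => //; rewrite s0.
apply: (@cvg_within_comp _ _ _ `[s, T]%classic (`[0, T]%classic `*` O)
  (fun t : R => (t, X s t x)) (fun q : R * 'rV[R]_d => mu q.1 q.2) t).
- apply: cvg_within_pair; last exact: Xc.
  by apply: cvg_within_filter; exact: cvg_id.
- exact: within_forall.
- by apply: muc; exact: IO.
Qed.

Lemma flow_ode s x t : 0 <= s <= T -> O x -> t \in `]s, T[ -> forall j,
  is_derive t 1 (fun t : R => X s t x 0 j) (mu t (X s t x) 0 j).
Proof.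
move=> sT Ox tsT j.
have muc : {within `[s, T], continuous (fun t => mu t (X s t x) 0 j)}.
  exact: (coord_comp_continuous (T := subspace `[s, T]) (field_along_flow_cont sT Ox)).
have dI := is_derive_Rintegral muc tsT.
have dx := @is_deriveD _ _ _ _ _ _ _ _ _ (is_derive_cst (x 0 j) t 1) dI.
rewrite add0r in dx; apply: near_eq_is_derive dx.
move: tsT; rewrite in_itv /= => /andP[st tT].
near=> r; rewrite !fctE /= X_eq.
- by rewrite !mxE.
- case/andP: sT => -> _ /=.
  by apply: ltW; near: r; exact: lt_nbhsr.
- by apply: ltW; near: r; exact: lt_nbhsl.
- by [].
Unshelve. all: by end_near. Qed.

(** Both sides solve the same equation from time [r], and Gronwall's inequality
    forces their difference to vanish. The vector field is Lipschitz only near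
    the curve; where the two solutions are at distance at least [e], a Lipschitz
    bound follows instead from the boundedness of the field along each of
    them. *)
Lemma curve_flow s r : 0 <= s <= r -> r <= T ->
  X r T (curve (s, r)) = curve (s, T).
Proof.
move=> /andP[s0 sr] rT.
have sT : 0 <= s <= T by rewrite s0 (le_trans sr).
have rT' : 0 <= r <= T by rewrite rT (le_trans s0).
have Ox : O (curve (s, r)) by apply: curve_O; split => //=; rewrite s0.
set x := curve (s, r) in Ox *.
have YsO := Y_O sT.
have [M M0 [e e0 muL]] := mu_lipschitz.
have [B1 B10 muB1] : exists2 B : R, 0 < B & forall p, simplex p ->
    `|mu p.2 (curve p)| <= B.
  by case: mu_C01 => muc _ _; exact: (along_curve_bounded muc).
have [B2 B20 muB2] : exists2 B : R, 0 < B & forall t : R, t \in `[r, T] ->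
    `|mu t (X r t x)| <= B.
  have := compact_bounded (continuous_compact (field_along_flow_cont rT' Ox) (@segment_compact _ r T)).
  move=> /ex_strict_bound_gt0[B B0 BF]; exists B => // t trT.
  by apply/ltW/BF; exists t.
pose u t := X r t x - X s t (Y s).
pose g t := mu t (X r t x) - mu t (X s t (Y s)).
(* [M] serves where [u] is smaller than [e], and [(B1 + B2) / e] elsewhere *)
pose M' := M + (B1 + B2) / e.
have M'0 : 0 < M' by rewrite addr_gt0// divr_gt0// addr_gt0.
have sub t : t \in `[r, T] -> t \in `[s, T].
  by rewrite !in_itv /= => /andP[rt ->]; rewrite (le_trans sr).
have uc : {within `[r, T], continuous u}.
  move=> t; apply: (@cvgB _ _ _ (nbhs t)); first exact: flow_time_cont.
  move: t; apply: (@continuous_subspaceW _ _ `[r, T] `[s, T]).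
    by move=> t; exact: sub.
  exact: flow_time_cont.
have ud (t : R) : t \in `]r, T[ ->
    forall j, is_derive t 1 (fun t : R => u t 0 j) (g t 0 j).
  move=> trT j; have tsT : t \in `]s, T[.
    by move: trT; rewrite !in_itv /= => /andP[rt ->]; rewrite (le_lt_trans sr).
  have := is_deriveB (flow_ode rT' Ox trT j) (flow_ode sT YsO tsT j).
  rewrite [X in is_derive _ _ X _](_ : _ = (fun t => u t 0 j)); last first.
    by apply/funext => y; rewrite /u !mxE.
  by rewrite /g !mxE.
have gu (t : R) : t \in `]r, T[ -> `|g t| <= M' * `|u t| + 0.
  rewrite in_itv /= addr0 => /andP[rt tT].
  have Sp : simplex (s, t).
    by split; rewrite /= ?s0 ?(ltW tT)// (le_trans sr)// ltW.
  have [ue|ue] := ltP `|u t| e.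
    have := muL _ ue _ Sp; rewrite /= /curve /= /u [_ + (_ - _)]addrC subrK => H.
    apply: (le_trans H); rewrite ler_wpM2r// lerDl.
    by rewrite divr_ge0 ?addr_ge0 ?ltW.
  apply: (@le_trans _ _ (B1 + B2)).
    apply: (le_trans (ler_normB _ _)); rewrite addrC lerD//.
      exact: (muB1 _ Sp).
    by apply: muB2; rewrite in_itv /= !ltW.
  rewrite mulrDl ler_wpDl//; first by rewrite mulr_ge0// ltW.
  by rewrite mulrAC ler_pdivlMr// ler_wpM2l// addr_ge0 ?ltW.
have := gronwall rT M'0 (lexx 0) uc ud gu.
move=> /(_ T); rewrite in_itv /= rT lexx => /(_ isT).
rewrite /u flow_init// subrr normr0 mul0r addr0 mulr0 mul0r.
by rewrite normr_le0 subr_eq0 => /eqP.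
Qed.

(** * Deviations from the trajectories started on [Y] *)

Let deviation s w t := X s t (Y s + w) - curve (s, t).

Lemma start_nbhs_O : exists2 r : R, 0 < r &
  forall w, `|w| < r -> forall s, 0 <= s <= T -> O (Y s + w).
Proof.
have [r r0 rO] := curve_nbhs_O; exists r => // w wr s /[dup] sT /andP[s0 _].
have := rO _ wr (s, s); rewrite /curve /= flow_init//; last exact: Y_O.
by apply; split; rewrite /= ?s0 ?lexx//; case/andP: sT.
Qed.

Lemma deviation_init s w : 0 <= s <= T -> O (Y s + w) -> deviation s w s = w.
Proof.
move=> sT Ow; rewrite /deviation /curve /= flow_init// flow_init//; last exact: Y_O.
by rewrite addrC addKr.
Qed.

Lemma deviation_cont s w : 0 <= s <= T -> O (Y s + w) ->
  {within `[s, T], continuous (deviation s w)}.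
Proof.
move=> sT Ow t; apply: (@cvgB _ _ _ (nbhs t)); first exact: flow_time_cont.
by apply: flow_time_cont => //; exact: Y_O.
Qed.

Let drift_gap s w t := mu t (X s t (Y s + w)) - mu t (curve (s, t)).

Lemma deviation_ode s w t : 0 <= s <= T -> O (Y s + w) -> t \in `]s, T[ -> forall j,
  is_derive t 1 (fun t : R => deviation s w t 0 j) (drift_gap s w t 0 j).
Proof.
move=> sT Ow tsT j.
have := is_deriveB (flow_ode sT Ow tsT j) (flow_ode sT (Y_O sT) tsT j).
rewrite [X in is_derive _ _ X _](_ : _ = (fun t => deviation s w t 0 j)); last first.
  by apply/funext => y; rewrite /deviation !mxE.
by rewrite /drift_gap !mxE.
Qed.

Lemma deviation_small (e : R) : 0 < e -> exists2 r : R, 0 < r &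
  forall w, `|w| < r -> forall s, 0 <= s <= T -> O (Y s + w) /\
    forall t : R, t \in `[s, T] -> simplex (s, t) /\ `|deviation s w t| < e.
Proof.
move=> e0; have [r r0 rO] := start_nbhs_O; have [r' r'0 rX] := deviation_uniform e0.
exists (Num.min r r'); first by rewrite lt_min r0.
move=> w; rewrite lt_min => /andP[wr wr'] s /[dup] sT /andP[s0 _].
split => [|t]; first exact: rO.
rewrite in_itv /= => /andP[st tT].
have Sp : simplex (s, t) by split; rewrite /= ?s0.
by split => //; exact: (rX _ wr' _ Sp).
Qed.

Lemma deviation_le : exists2 C : R, 0 < C & exists2 r : R, 0 < r &
  forall w, `|w| < r -> forall s, 0 <= s <= T ->
    forall t : R, t \in `[s, T] -> `|deviation s w t| <= C * `|w|.
Proof.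
have [M M0 [e e0 muL]] := mu_lipschitz; have [r r0 rS] := deviation_small e0.
exists (2 * expR (2 * M * T)); first by rewrite mulr_gt0// expR_gt0.
exists r => // w wr s sT t tsT; have [Ow Sw] := rS _ wr _ sT.
have sT' : s <= T by case/andP: sT.
have gu (q : R) : q \in `]s, T[ ->
    `|drift_gap s w q| <= M * `|deviation s w q| + 0.
  rewrite in_itv /= addr0 => /andP[sq qT].
  have [|Sp ps] := Sw q; first by rewrite in_itv /= !ltW.
  by have := muL _ ps _ Sp; rewrite /= /deviation [_ + (_ - _)]addrC subrK.
have := gronwall sT' M0 (lexx 0) (deviation_cont sT Ow)
  (fun t => @deviation_ode s w t sT Ow) gu tsT.
move=> /le_trans; apply; rewrite deviation_init// mul0r addr0 mulrAC ler_wpM2r//.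
rewrite ler_wpM2l// ler_expR ler_wpM2l ?mulr_ge0 ?(ltW M0)//.
by rewrite lerBlDr lerDl; case/andP: sT.
Qed.

(** The defect of linearity starts at [0] and satisfies the linearized equation
    up to a remainder that is small compared with the shifts, by [mu_taylor] and
    [deviation_le]; Gronwall's inequality bounds it at time [T]. *)
Lemma deviation_approx_linear (e : R) : 0 < e -> exists2 r : R, 0 < r &
  forall s, 0 <= s <= T -> forall (a b : R) (x y : 'rV[R]_d),
    `|x| < r -> `|y| < r -> `|a *: x + b *: y| < r ->
    `|deviation s (a *: x + b *: y) T - (a *: deviation s x T + b *: deviation s y T)| <=
      e * (`|a *: x + b *: y| + `|a *: x| + `|b *: y|).
Proof.
move=> e0.
have [C C0 [r1 r10 pC]] := deviation_le.
case: mu_C01 => _ _ Jc; have [M0 M00 JM] := along_curve_bounded Jc.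
pose M := d%:R * M0 + 1.
have Mp : 0 < M by rewrite ltr_wpDl// mulr_ge0// ltW.
(* [K] collects the constants of both applications of Gronwall's inequality,
   so that the final bound has the factor [e] *)
pose K := 2 * T * expR (2 * M * T) * C.
have K0 : 0 < K by rewrite !mulr_gt0// expR_gt0.
have e1 : 0 < e / K by rewrite divr_gt0.
have [r2 r20 muT] := mu_taylor e1.
have [r3 r30 pS] := deviation_small r20.
exists (Num.min r1 r3); first by rewrite lt_min r10.
move=> s sT a b x y; rewrite !lt_min.
set z := a *: x + b *: y.
move=> /andP[x1 x3] /andP[y1 y3] /andP[z1 z3].
have [Ox Sx] := pS _ x3 _ sT; have [Oy Sy] := pS _ y3 _ sT.
have [Oz Sz] := pS _ z3 _ sT.
pose A t := 'J (mu t) (curve (s, t)).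
pose rem w t := drift_gap s w t - deviation s w t *m A t.
have rem_le w : `|w| < r1 -> `|w| < r3 -> forall t : R, t \in `[s, T] ->
    `|rem w t| <= e / K * (C * `|w|).
  move=> w1 w3 t tsT; have [_ /(_ t tsT)[Sp pw]] := pS _ w3 _ sT.
  have := muT _ pw _ Sp; rewrite /= /deviation [_ + (_ - _)]addrC subrK => H.
  apply: (le_trans H); rewrite ler_pM2l//; exact: pC.
pose u t := deviation s z t - (a *: deviation s x t + b *: deviation s y t).
pose g t := drift_gap s z t - (a *: drift_gap s x t + b *: drift_gap s y t).
pose N := `|z| + `|a *: x| + `|b *: y|.
have uc : {within `[s, T], continuous u}.
  move=> t; apply: (@cvgB _ _ _ (nbhs t)); first exact: deviation_cont.
  apply: (@cvgD _ _ _ (nbhs t)); apply: cvgZ; first exact: cvg_cst.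
  - exact: deviation_cont.
  - exact: cvg_cst.
  - exact: deviation_cont.
have coordE (p q r : 'rV[R]_d) j :
    (p - (a *: q + b *: r)) 0 j = p 0 j - (a *: q 0 j + b *: r 0 j).
  by rewrite !mxE.
have ud (t : R) : t \in `]s, T[ ->
    forall j, is_derive t 1 (fun t : R => u t 0 j) (g t 0 j).
  move=> tsT j.
  have := is_deriveB (deviation_ode sT Oz tsT j)
    (is_deriveD (is_deriveZ a (deviation_ode sT Ox tsT j))
                (is_deriveZ b (deviation_ode sT Oy tsT j))).
  rewrite [X in is_derive _ _ X _](_ : _ = (fun t => u t 0 j)); last first.
    by apply/funext => q; rewrite /u coordE.
  by rewrite /g coordE.
have gu (t : R) : t \in `]s, T[ -> `|g t| <= M * `|u t| + e / K * C * N.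
  move=> tsT.
  have tsT' : t \in `[s, T].
    by move: tsT; rewrite !in_itv /= => /andP[/ltW-> /ltW->].
  have gE : g t = u t *m A t + (rem z t - (a *: rem x t + b *: rem y t)).
    rewrite /g /u /rem (mulmxBl (deviation s z t)) (mulmxDl (a *: deviation s x t)) -!scalemxAl.
    move: (drift_gap s z t) (drift_gap s x t) (drift_gap s y t)
      (deviation s z t *m A t) (deviation s x t *m A t) (deviation s y t *m A t) => *.
    by apply/rowP => i; rewrite !mxE; ring.
  rewrite gE; apply: (le_trans (ler_normD _ _)); apply: lerD.
    apply: (le_trans (norm_mulmx_le _ _)); rewrite ler_wpM2r//.
    rewrite /M ler_wpDr// ler_wpM2l//.
    by have [Sp _] := Sx _ tsT'; exact: (JM _ Sp).
  apply: (le_trans (ler_normB _ _)).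
  apply: (@le_trans _ _ (e / K * (C * `|z|) +
     (`|a| * (e / K * (C * `|x|)) + `|b| * (e / K * (C * `|y|))))).
    apply: lerD; first exact: rem_le.
    apply: (le_trans (ler_normD _ _)).
    by apply: lerD; rewrite normrZ ler_wpM2l//; exact: rem_le.
  by rewrite /N !normrZ le_eqVlt; apply/orP; left; apply/eqP; ring.
have sT' : s <= T by case/andP: sT.
have N0 : 0 <= N by rewrite /N !addr_ge0.
have b0 : 0 <= e / K * C * N by rewrite mulr_ge0// mulr_ge0// ltW.
have := gronwall sT' Mp b0 uc ud gu (t := T).
rewrite in_itv /= sT' lexx => /(_ isT).
rewrite /u !deviation_init// subrr normr0 add0r => /le_trans; apply.
have -> : e * N = 2 * (e / K * C * N * T) * expR (2 * M * T).
  rewrite -[e in LHS](divfK (lt0r_neq0 K0)) {2}/K; ring.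
have Ts : T - s <= T by rewrite lerBlDr lerDl; case/andP: sT.
apply: ler_pM; rewrite ?expR_ge0//.
- by rewrite mulr_ge0// mulr_ge0// subr_ge0.
- by rewrite ler_wpM2l// ler_wpM2l.
- by rewrite ler_expR ler_wpM2l// mulr_ge0// ltW.
Qed.

(** * Differentiability of the flow in the starting point *)

Let expands (J : R -> 'M[R]_d) := forall e : R, 0 < e ->
  exists2 r : R, 0 < r & forall s, 0 <= s <= T -> forall w : 'rV[R]_d,
    `|w| < r -> `|deviation s w T - w *m J s| <= e * `|w|.

Lemma flow_expansion : exists J, expands J.
Proof.
exact: (@approx_linear_derivative R _ [set s : R | 0 <= s <= T] _ _
  (fun s w => deviation s w T) deviation_approx_linear).
Qed.

Lemma flow_jacobianE J s : expands J -> 0 <= s <= T ->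
  differentiable (X s T) (Y s) /\ 'J (X s T) (Y s) = J s.
Proof.
move=> JE sT; apply: differentiable_of_expansion => e e0.
have [r r0 Hr] := JE _ e0; apply/nbhs_normP; exists r => //= w.
rewrite /ball_ /= sub0r normrN => wr; rewrite [w + _]addrC.
exact: Hr.
Qed.

Lemma flow_differentiable s : 0 <= s <= T -> differentiable (X s T) (Y s).
Proof. by move=> sT; have [J JE] := flow_expansion; exact: (flow_jacobianE JE sT).1. Qed.

Lemma curve_end_cont : {within `[0, T], continuous (fun s => X s T (Y s))}.
Proof.
apply/subspace_continuousP => s /=; rewrite in_itv /= => sT.
apply: (@cvg_within_comp _ _ _ `[0, T]%classic simplex (fun s => (s, T)) curve s).
- apply: cvg_within_pair; last exact: cvg_cst.
  by apply: cvg_within_filter; exact: cvg_id.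
- by apply: within_forall => q /=; rewrite in_itv.
- exact: curve_cvg.
Qed.

(** Each row of the Jacobian matrix is, uniformly in [s], close to a difference
    quotient with a fixed increment, which is continuous in [s]. *)
Lemma flow_jacobian_cont :
  {within `[0, T], continuous (fun s => 'J (X s T) (Y s))}.
Proof.
have third_split (e : R) : e = e / 3 + (e / 3 + e / 3) by field.
have [J JE] := flow_expansion; apply/subspace_continuousP => s /=.
rewrite in_itv /= => sT; apply: cvg_mx_entries => i j.
apply/cvgrPdist_le => e e0; have e1 : 0 < e / 3 by rewrite divr_gt0.
have [r r0 Jr] := JE _ e1; have [r' r'0 rO] := start_nbhs_O.
(* a fixed increment, admissible for the expansion and keeping the shifted
   starting points in [O] *)
pose h := Num.min r r' / 2.
have m0 : 0 < Num.min r r' by rewrite lt_min r0.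
have h0 : 0 < h by rewrite divr_gt0.
pose w : 'rV[R]_d := h *: delta_mx 0 i.
have wh : `|w| <= h.
  rewrite normrZ gtr0_norm// ler_piMr// ?(ltW h0)//.
  apply: mx_norm_le => // i' j'; rewrite mxE.
  by case: (_ && _); rewrite ?normr1 ?normr0.
have /andP[wr wr'] : (`|w| < r) && (`|w| < r').
  rewrite -lt_min; apply: (le_lt_trans wh).
  by rewrite /h ltr_pdivrMr// ltr_pMr// ltr1n.
have Jh q : 0 <= q <= T ->
    `|h^-1 * deviation q w T 0 j - 'J (X q T) (Y q) i j| <= e / 3.
  move=> qT; have [_ ->] := flow_jacobianE JE qT.
  have -> : h^-1 * deviation q w T 0 j - J q i j =
      h^-1 * (deviation q w T - w *m J q) 0 j.
    have -> : (deviation q w T - w *m J q) 0 j = deviation q w T 0 j - h * J q i j.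
      by rewrite mx_subE; congr (_ - _); rewrite /w -scalemxAl -rowE !mxE.
    by rewrite mulrBr mulrA mulVf ?mul1r// gt_eqF.
  rewrite normrM normfV (gtr0_norm h0) ler_pdivrMl//.
  apply: (le_trans (mx_entry_le_norm _ _ _)); apply: (le_trans (Jr q qT w wr)).
  by rewrite mulrC ler_wpM2r// ltW.
have pc : (fun q => deviation q w T) @ within `[0, T] (nbhs s) --> deviation s w T.
  apply: cvgB; last by have /subspace_continuousP := curve_end_cont; apply; rewrite /= in_itv.
  apply: (@cvg_within_comp _ _ _ `[0, T]%classic
    [set q : R * R * 'rV[R]_d | simplex q.1] (fun q => (q, T, w))
    (fun q => X q.1.1 q.1.2 (Y q.1.1 + q.2)) s).
  - apply: cvg_within_pair; last exact: cvg_cst.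
    apply: cvg_within_pair; last exact: cvg_cst.
    by apply: cvg_within_filter; exact: cvg_id.
  - by apply: within_forall => q /=; rewrite in_itv.
  - by apply: flow_shifted_cont => //; exact: rO.
have e2 : 0 < h * (e / 3) by rewrite mulr_gt0.
have /cvgrPdist_le/(_ _ e2) := pc.
have : \forall q \near within `[0, T] (nbhs s), 0 <= q <= T.
  by apply: within_forall => q /=; rewrite in_itv.
apply: filterS2 => q qT pq.
have H1 := Jh _ qT; have H2 := Jh _ sT.
have H3 : `|h^-1 * deviation s w T 0 j - h^-1 * deviation q w T 0 j| <= e / 3.
  rewrite -mulrBr normrM normfV (gtr0_norm h0) ler_pdivrMl//.
  apply: le_trans pq.
  have -> : deviation s w T 0 j - deviation q w T 0 j = (deviation s w T - deviation q w T) 0 j.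
    by rewrite mx_subE.
  exact: mx_entry_le_norm.
rewrite (third_split e).
apply: le_trans (ler_distD (h^-1 * deviation s w T 0 j) _ _) _.
apply: lerD; first by rewrite distrC; exact: H2.
apply: le_trans (ler_distD (h^-1 * deviation q w T 0 j) _ _) _.
by apply: lerD; [exact: H3|exact: H1].
Qed.

(** * The Alekseev-Groebner formula *)

Lemma velocity_defect_cont :
  {within `[0, T], continuous (fun s => mu s (Y s) - derive1_within `[0, T] Y s)}.
Proof.
apply/subspace_continuousP => s /= /[dup] sI; rewrite in_itv /= => sT.
apply: cvgB; last by have /subspace_continuousP := Y_C1.2; apply.
case: mu_C01 => /subspace_continuousP muc _ _.
apply: (@cvg_within_comp _ _ _ `[0, T]%classic (`[0, T]%classic `*` O)
  (fun t : R => (t, Y t)) (fun q : R * 'rV[R]_d => mu q.1 q.2) s).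
- apply: cvg_within_pair; last exact: Y_cont.
  by apply: cvg_within_filter; exact: cvg_id.
- by apply: within_forall => q /= qI; split => //; apply: Y_O; rewrite in_itv /= in qI.
- by apply: muc; split => //; exact: Y_O.
Qed.

(** The starting point of the chord moves with [h], so the time derivative of
    the flow at [t] does not apply; the mean value theorem gives the slope as
    [mu] at an intermediate point, which tends to [(t, Y t)] by joint
    continuity. *)
Lemma flow_chord_left_derivative t j : 0 < t <= T ->
  h^-1 * ((X (h + t) t (Y (h + t)) - Y (h + t)) 0 j) @[h --> (0 : R)^'-]
    --> - mu t (Y t) 0 j.
Proof.
move=> /andP[t0 tT]; apply/cvgrPdist_le => e e0.
have St : simplex (t, t) by split => //=; rewrite lexx ltW.
have tT' : 0 <= t <= T by rewrite tT ltW.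
have ct : curve (t, t) = Y t by rewrite /curve /= flow_init//; exact: Y_O.
have [r r0 Hr] : exists2 r : R, 0 < r & forall p : R * R, `|t - p.1| < r ->
    `|t - p.2| < r -> simplex p -> `|mu t (Y t) - mu p.2 (curve p)| <= e.
  case: mu_C01 => muc _ _.
  have /cvgrPdist_le/(_ _ e0) := along_curve_cont muc St.
  rewrite /= ct => /nbhs_ballP[r /= r0 rb]; exists r => // p p1 p2 Sp.
  by apply: rb => //; split; rewrite /= -ball_normE.
near=> h.
have h0 : h < 0 by near: h; exact: nbhs_left_lt.
have hr : - h < r.
  by rewrite ltrNl; near: h; apply: nbhs_left_gt; rewrite oppr_lt0.
have ht : - h < t.
  by rewrite ltrNl; near: h; apply: nbhs_left_gt; rewrite oppr_lt0.
set s := h + t.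
have st : s < t by rewrite /s gtrDr.
have s0 : 0 <= s by rewrite /s addrC -[h]opprK subr_ge0 ltW.
have sT : 0 <= s <= T by rewrite s0 (le_trans (ltW st)).
have YsO := Y_O sT.
have sub q : q \in `[s, t] -> q \in `[s, T].
  by rewrite !in_itv /= => /andP[-> qt]; rewrite (le_trans qt).
have Xc : {within `[s, t], continuous (fun q => X s q (Y s) 0 j)}.
  apply: (coord_comp_continuous (T := subspace `[s, t]) (u := fun q => X s q (Y s))).
  apply: (@continuous_subspaceW _ _ `[s, t] `[s, T]).
    by move=> q; exact: sub.
  exact: flow_time_cont.
have Xd (q : R) : q \in `]s, t[ ->
    is_derive q 1 (fun q => X s q (Y s) 0 j) (mu q (X s q (Y s)) 0 j).
  rewrite in_itv /= => /andP[sq qt]; apply: flow_ode => //.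
  by rewrite in_itv /= sq (lt_le_trans qt).
have [q] := MVT st Xd Xc.
rewrite in_itv /= flow_init// => /andP[sq qt] qE.
have -> : (X s t (Y s) - Y s) 0 j = mu q (X s q (Y s)) 0 j * (t - s).
  by rewrite -qE mx_subE.
have -> : t - s = - h by rewrite /s opprD addrCA subrr addr0.
rewrite !mulrN mulrCA mulVf ?lt_eqF// mulr1 -opprD normrN.
have Sq : simplex (s, q) by split; rewrite /= ?s0 ?(ltW sq)// (le_trans (ltW qt)).
have -> : mu t (Y t) 0 j - mu q (X s q (Y s)) 0 j =
    (mu t (Y t) - mu q (curve (s, q))) 0 j by rewrite mx_subE.
apply: (le_trans (mx_entry_le_norm _ _ _)); apply: (Hr (s, q)) => //=.
  by rewrite /s opprD addrCA subrr addr0 gtr0_norm// oppr_gt0.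
rewrite gtr0_norm ?subr_gt0//; apply: lt_trans hr.
by rewrite ltrBlDr -ltrBlDl opprK addrC.
Unshelve. all: by end_near. Qed.

Lemma curve_left_derivative t : 0 < t <= T ->
  h^-1 *: (curve (h + t, t) - Y t) @[h --> (0 : R)^'-]
    --> derive1_within `[0, T] Y t - mu t (Y t).
Proof.
move=> /[dup] t0T /andP[t0 tT].
have tI : `[0, T]%classic t by rewrite /= in_itv /= tT ltW.
have Yt : h^-1 *: (Y (h + t) - Y t) @[h --> (0 : R)^'-]
    --> derive1_within `[0, T] Y t.
  have := Y_C1.1 t tI; rewrite /derivable1_within => Yc.
  apply: cvg_trans Yc; apply: cvg_app => P.
  rewrite /within /= => P0.
  have ht : \forall h \near (0 : R), - t < h by apply: lt_nbhsr; rewrite oppr_lt0.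
  suff : \forall h \near (0 : R), h < 0 -> P h by [].
  apply: (@filterS2 _ (nbhs (0 : R)) _ _ _ _ _ P0 ht) => h Ph th h0.
  apply: Ph; first by rewrite lt_eqF.
  rewrite in_itv /= -lerBlDr sub0r ltW//=.
  by apply: le_trans tT; rewrite gerDr ltW.
have -> : (fun h => h^-1 *: (curve (h + t, t) - Y t)) =
    (fun h => h^-1 *: (Y (h + t) - Y t)) +
    (fun h => h^-1 *: (curve (h + t, t) - Y (h + t))).
  by apply/funext => h; rewrite !fctE -scalerDr [in RHS]addrC addrA subrK.
apply: cvgD => //; apply: cvg_mx_entries => i j; rewrite (ord1 i) {i}.
rewrite [X in _ --> X]mxE.
have -> : (fun h => (h^-1 *: (curve (h + t, t) - Y (h + t))) 0 j) =
    (fun h => h^-1 * (X (h + t) t (Y (h + t)) - Y (h + t)) 0 j).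
  by apply/funext => h; rewrite mxE.
exact: flow_chord_left_derivative.
Qed.

Variables (k : nat) (f : 'rV[R]_d -> 'rV[R]_k) (f_C1 : C1_space O f).

Let integrand (s : R) := 'd f (X s T (Y s))
  ('d (X s T) (Y s) (mu s (Y s) - derive1_within `[0, T] Y s)).

Lemma integrand_cont : {within `[0, T], continuous integrand}.
Proof.
apply/subspace_continuousP => s /[dup] sI; rewrite /= in_itv /= => sT.
have -> : integrand = (fun s => (mu s (Y s) - derive1_within `[0, T] Y s)
    *m 'J (X s T) (Y s) *m 'J f (X s T (Y s))).
  by apply/funext => q; rewrite /integrand !jacobianE.
apply: cvg_mulmx; last first.
  apply: (@cvg_within_comp _ _ _ `[0, T]%classic O (fun s => X s T (Y s))
    (fun x => 'J f x) s).
  - by have /subspace_continuousP := curve_end_cont; exact.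
  - by apply: within_forall => q /=; rewrite in_itv /= => qT; exact: (@curve_O (q, T)).
  - have /subspace_continuousP := f_C1.2; apply.
    exact: (@curve_O (s, T)).
apply: cvg_mulmx.
  by have /subspace_continuousP := velocity_defect_cont; exact.
by have /subspace_continuousP := flow_jacobian_cont; exact.
Qed.

(** By the flow property the increment is that of [f \o X t T] between
    [curve (h + t, t)] and [Y t]. *)
Lemma left_derivative_along_curve t : 0 < t <= T ->
  h^-1 *: (f (X (h + t) T (Y (h + t))) - f (X t T (Y t))) @[h --> (0 : R)^'-]
    --> - integrand t.
Proof.
move=> /[dup] t0T /andP[t0 tT].
have tT' : 0 <= t <= T by rewrite tT ltW.
pose H := f \o X t T.
have dX : differentiable (X t T) (Y t) by exact: flow_differentiable.
have df : differentiable f (X t T (Y t)) by apply: f_C1.1; exact: (@curve_O (t, T)).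
have dH : differentiable H (Y t) by exact: differentiable_comp.
have := left_derivative_comp dH (curve_left_derivative t0T).
have -> : (derive1_within `[0, T] Y t - mu t (Y t)) *m 'J H (Y t) = - integrand t.
  by rewrite -jacobianE /H diff_comp//= /integrand -!linearN opprB.
apply: cvg_trans; apply: near_eq_cvg.
near=> h.
have h0 : h < 0 by near: h; exact: nbhs_left_lt.
have ht : - t < h by near: h; apply: nbhs_left_gt; rewrite oppr_lt0.
rewrite /H /= curve_flow// -lerBlDr sub0r ltW//=.
by rewrite gerDr ltW.
Unshelve. all: by end_near. Qed.

Lemma alekseev_groebner : vintegrable `[0, T] integrand /\
  f (X 0 T (Y 0)) - f (Y T) = vintegral `[0, T] integrand.
Proof.
have ic j : {within `[0, T], continuous (fun s => integrand s 0 j)}.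
  exact: (coord_comp_continuous (T := subspace `[0, T]) integrand_cont).
have T0T : 0 <= T <= T by rewrite lexx ltW.
split.
  move=> j; apply: continuous_compact_integrable; first exact: segment_compact.
  exact: ic.
apply/rowP => j; rewrite mx_subE [RHS]mxE.
have XTT : X T T (Y T) = Y T by rewrite flow_init//; exact: Y_O.
have fc : {within `[0, T], continuous (fun s => - f (X s T (Y s)) 0 j)}.
  move=> s; apply: (@cvgN _ _ _ (nbhs s)); move: s.
  apply: (coord_comp_continuous (T := subspace `[0, T]) (u := fun s => f (X s T (Y s)))).
  apply/subspace_continuousP => s sI.
  have sT : 0 <= s <= T by rewrite /= in_itv /= in sI.
  have /subspace_continuousP/(_ _ sI) Xs := curve_end_cont.
  have df : differentiable f (X s T (Y s)) by apply: f_C1.1; exact: (@curve_O (s, T)).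
  exact: (@cvg_comp _ _ _ (fun s => X s T (Y s)) f _ _ _ Xs (differentiable_continuous df)).
have fl (t : R) : t \in `]0, T] ->
    h^-1 * (- f (X (h + t) T (Y (h + t))) 0 j - - f (X t T (Y t)) 0 j)
      @[h --> (0 : R)^'-] --> integrand t 0 j.
  rewrite in_itv /= => tT.
  have -> : (fun h => h^-1 * (- f (X (h + t) T (Y (h + t))) 0 j - - f (X t T (Y t)) 0 j)) =
      (fun h => - (h^-1 *: (f (X (h + t) T (Y (h + t))) - f (X t T (Y t)))) 0 j).
    by apply/funext => h; rewrite mxE mx_subE -opprD mulrN.
  have -> : integrand t 0 j = - (- integrand t) 0 j by rewrite mxE opprK.
  apply: cvgN.
  exact: (@cvg_comp _ _ _ _ (fun A : 'rV[R]_k => A 0 j) _ _ _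
    (left_derivative_along_curve tT) (@coord_continuous R 1 k 0 j _)).
have := left_derivative_FTC T_gt0 fc (ic j) fl.
by rewrite XTT opprK addrC.
Qed.

End Flow.

Theorem proposition2p1 (R : realType) (d k : nat) (d_gt0 : (0 < d)%N)
    (k_gt0 : (0 < k)%N) (T : R) (T_gt0 : 0 < T)
    (O : set 'rV[R]_d) (O_neq0 : O !=set0) (O_open : open O)
    (mu : R -> 'rV[R]_d -> 'rV[R]_d) (mu_C01 : C01 `[0, T] O mu)
    (Y : R -> 'rV[R]_d) (Y_C1 : C1_time `[0, T] Y)
    (Y_O : forall s, 0 <= s <= T -> O (Y s))
    (X : R -> R -> 'rV[R]_d -> 'rV[R]_d)
    (X_cont : {within
       [set p : R * R * 'rV[R]_d | 0 <= p.1.1 <= p.1.2 /\ p.1.2 <= T /\ O p.2],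
       continuous (fun p : R * R * 'rV[R]_d => X p.1.1 p.1.2 p.2)})
    (X_O : forall s t x, 0 <= s <= t -> t <= T -> O x -> O (X s t x))
    (f : 'rV[R]_d -> 'rV[R]_k) (f_C1 : C1_space O f)
    (X_eq : forall s t x, 0 <= s <= t -> t <= T -> O x ->
       X s t x = x + vintegral `[s, t] (fun r => mu r (X s r x))) :
  let integrand := fun s : R =>
    'd f (X s T (Y s))
      ('d (X s T) (Y s) (mu s (Y s) - derive1_within `[0, T] Y s)) in
  [/\ (forall s, 0 <= s <= T -> differentiable (X s T) (Y s)),
      vintegrable `[0, T] integrand &
      f (X 0 T (Y 0)) - f (Y T) = vintegral `[0, T] integrand].
Proof.
move=> integrand.
have [integrable formula] := alekseev_groebner
  T_gt0 O_open mu_C01 Y_C1 Y_O X_cont X_O X_eq f_C1.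
split=> // s sT.
exact: (flow_differentiable T_gt0 O_open mu_C01 Y_C1 Y_O X_cont X_O X_eq sT).
Qed.
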